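(* Let $q$ be an integer with $1\le q\le 100$ and let $k=q+1$. Then the generalized Chazy differential system $$\dot x=y,\qquad \dot y=z,\qquad \dot z=-|x|^q z-\frac{k|x|^q}{x}\,y^2$$ in $\mathbb{R}^3$ has an invariant cylinder foliated by periodic orbits.
   Context: The system is the first-order form, with $(x,y,z)=(x,\dot x,\ddot x)$, of the generalized Chazy differential equation $\dddot x+|x|^q\ddot x+\frac{k|x|^q}{x}\dot x^2=0$. For $q>1$ the function $|x|^q/x$ is extended by $0$ at $x=0$; the system is polynomial for $q$ even and continuous for $q>1$ odd. For $q=1$ the system is discontinuous on $x=0$ (there $|x|/x=\operatorname{sign}(x)$ for $x\neq 0$) and its trajectories are understood according to Filippov's convention. ''Invariant cylinder foliated by periodic orbits'' means an invariant topological cylinder in the $(x,y,z)$-space, i.e. an invariant subset $C\subset\mathbb{R}^3$ homeomorphic to $S^1\times\mathbb{R}$, which is a disjoint union of (non-constant) periodic orbits of the system, these orbits being the circles of the cylinder (the images of the sets $S^1\times\{s\}$ under a homeomorphism $S^1\times\mathbb{R}\to C$). *)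

(* Defs.v *)
From HB Require Import structures.
From mathcomp Require Import all_boot all_order all_algebra.
From mathcomp Require Import all_classical all_reals all_analysis.

Set Implicit Arguments.
Unset Strict Implicit.
Unset Printing Implicit Defensive.

Import Order.TTheory GRing.Theory Num.Theory numFieldNormedType.Exports.

Local Open Scope classical_set_scope.
Local Open Scope ring_scope.

(* At [x = 0] the quotient [`|x| ^+ q / x] is [0] (as [0^-1 = 0] in MathComp),
   which is the required extension for [1 < q]; for [q = 1] this value is
   irrelevant, since Filippov's convention ignores the values of the field on
   the null set [x = 0]. *)
Definition chazy_field (R : realType) (q : nat) (k : R) (p : R * R * R) :
    R * R * R :=
  let: (x, y, z) := p in
  (y, z, - `|x| ^+ q * z - k * `|x| ^+ q / x * y ^+ 2).

Definition lebesgue3 (R : realType) : set (R * R * R) -> \bar R :=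
  ((@lebesgue_measure R \x @lebesgue_measure R) \x @lebesgue_measure R)%E.

Definition closed_convex_hull (R : realType) (V : normedModType R) (A : set V)
    : set V :=
  smallest [set B : set V | @convex_set R V B /\ closed B] A.

(* Filippov's set-valued regularization: the intersection, over radii [d > 0]
   and null sets [N], of the closed convex hulls of [f (B(p, d) \ N)]. *)
Definition filippov_set (R : realType) (f : R * R * R -> R * R * R)
    (p : R * R * R) : set (R * R * R) :=
  \bigcap_(d in [set d : R | 0 < d])
    \bigcap_(N in [set N | (@lebesgue3 R).-negligible N])
      closed_convex_hull (f @` (ball p d `\` N)).

Definition absolutely_continuous_on (R : realType) (V : normedModType R)
    (a b : R) (g : R -> V) : Prop :=
  forall e : R, 0 < e -> exists2 d : R, 0 < d &
    forall (n : nat) (u v : nat -> R),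
      (forall i, (i < n)%N -> [/\ a <= u i, u i <= v i & v i <= b]) ->
      (forall i j, (i < j < n)%N -> v i <= u j) ->
      \sum_(i < n) (v i - u i) < d ->
      \sum_(i < n) `|g (v i) - g (u i)| < e.

Definition classical_solution (R : realType) (f : R * R * R -> R * R * R)
    (I : set R) (g : R -> R * R * R) : Prop :=
  forall t, I t -> is_derive t (1 : R) g (f (g t)).

Definition filippov_solution (R : realType) (f : R * R * R -> R * R * R)
    (I : set R) (g : R -> R * R * R) : Prop :=
  (forall a b : R, `[a, b]%classic `<=` I -> absolutely_continuous_on a b g) /\
  {ae @lebesgue_measure R, forall t, I t ->
    exists2 v, is_derive t (1 : R) g v & filippov_set f (g t) v}.

(* [I] is meant to be an open interval; the values of [g] outside [I] are
   irrelevant. *)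
Definition chazy_trajectory (R : realType) (q : nat) (k : R) (I : set R)
    (g : R -> R * R * R) : Prop :=
  if q == 1%N then filippov_solution (chazy_field q k) I g
  else classical_solution (chazy_field q k) I g.

(* Every trajectory meeting [C] stays in [C], forward and backward in time;
   bounded intervals suffice, as trajectories restrict to subintervals. *)
Definition chazy_invariant (R : realType) (q : nat) (k : R)
    (C : set (R * R * R)) : Prop :=
  forall (a b : R) (g : R -> R * R * R), chazy_trajectory q k `]a, b[%classic g ->
    forall t0, t0 \in `]a, b[ -> C (g t0) -> forall t, t \in `]a, b[ -> C (g t).

Definition chazy_periodic_orbit (R : realType) (q : nat) (k : R)
    (O : set (R * R * R)) : Prop :=
  exists (g : R -> R * R * R) (T : R),
    [/\ chazy_trajectory q k [set: R] g,
        0 < T,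
        forall t, g (t + T) = g t,
        exists t s, g t <> g s
      & O = range g].

Definition homeomorphism_between (X Y : topologicalType) (A : set X)
    (B : set Y) (phi : X -> Y) : Prop :=
  exists psi : Y -> X,
    [/\ {within A, continuous phi},
        {within B, continuous psi},
        forall x, A x -> B (phi x) /\ psi (phi x) = x
      & forall y, B y -> A (psi y) /\ phi (psi y) = y].

Definition unit_circle (R : realType) : set (R * R) :=
  [set p | p.1 ^+ 2 + p.2 ^+ 2 = 1].

(* Disjointness of the orbits, and the fact that they cover [C], come from the
   bijectivity of [phi]. *)
Definition chazy_cylinder_foliated_by_periodic_orbits (R : realType) (q : nat)
    (k : R) (C : set (R * R * R)) : Prop :=
  exists phi : R * R * R -> R * R * R,
    homeomorphism_between (@unit_circle R `*` [set: R]) C phi /\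
    forall s : R, chazy_periodic_orbit q k (phi @` (@unit_circle R `*` [set s])).

(* Main.v *)
(* For [k = q + 1] the function [H = x z - y^2/2 + x |x|^q y] is a first integral,
   homogeneous of degree [2q + 2] for the weights [(1, q + 1, 2q + 1)] of [(x, y, z)],
   for which the system is quasi-homogeneous.  Hence one periodic orbit with [H = -1/2]
   yields the cylinder formed by its dilations, on which [H] is the height.

   Let [beta = 2/(2q + 1)], [Y = y + beta x |x|^q] and
   [g = -2z - 2(1 + beta)|x|^q y - beta^2 x |x|^(2q)].  Then [-2H = x g + Y^2] and
   [g' = beta |x|^q / x * (-2H)].  If [H = -1/2], an arc in [0 < x] is parametrized by
   [t] in [[-1, 1]] through [x = (1 - t^2) / D], [Y = - t / sqrt D] with
   [D = t^2 + g (1 - t^2)], and the system becomes the scalar equation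
   [dg/dt = 2 beta (1 - t^2)^(q - 1) D^(-q - 1/2)], regular up to the end points, where
   [x = 0].  The system commutes with [v |-> - v], so the arc closes up with its opposite
   as soon as [g(1) = - g(-1)].  The right-hand side decreases in [g], so [g(1)] is a
   nondecreasing nonexpansive function of [g(-1)], and the intermediate value theorem
   gives a solution.

   Invariance of the cylinder is a uniqueness statement.  In the unknowns [x], [y] and
   [Z = z + (k/q) |x|^q y] the system is locally Lipschitz, also for [q = 1].  When
   [q = 1] a Filippov solution solves this regularized system near every time at which
   [(x, y) <> (0, 0)], because an absolutely continuous function is controlled by its
   derivative outside a null set. *)

Require Import Defs.
From mathcomp Require Import all_boot all_order all_algebra.
From mathcomp Require Import all_classical all_reals all_analysis.
From mathcomp Require Import ring lra.
Import Order.TTheory GRing.Theory Num.Theory numFieldNormedType.Exports.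
Local Open Scope classical_set_scope.
Local Open Scope ring_scope.

Set Implicit Arguments.
Unset Strict Implicit.
Unset Printing Implicit Defensive.

(** * Real functions *)

(** The number [beta] is the only one for which [g'] is [|x|^q / x] times a constant multiple of
    [H]: the coefficients of [|x|^q y^2 / x] and of [|x|^(2q) y] both ask for [beta (2q + 1) = 2].
    On an arc with [H = -1/2] one has [x + Y^2 = 1 / D], so [t = - Y / sqrt (x + Y^2)] is an angle
    adapted to the weights. Two obstacles shape the construction. The scalar equation blows up where
    [D = 0], while the shooting starts from nonpositive values of [g]; the blow-up itself raises
    [D], so a solution of an equation cut off at a small [D] never feels the cut-off. And with
    [t = - cos s] time has derivative [2 |sin s| D^(-3/2)], which vanishes where two arcs join;
    there the equations of motion come from the continuity of both sides. For uniqueness,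
    [x = y = 0] would give [H = 0], so the orbits avoid that line and their zeros of [x] are simple,
    hence isolated. Such a crossing leaves a Filippov solution no freedom. *)

Section real_functions.
Context {R : realType}.
Implicit Types (f g : R -> R) (t : R).

Lemma is_derive_der f t (a b : R) : is_derive t 1 f a -> a = b -> is_derive t 1 f b.
Proof. by move=> ? <-. Qed.

Lemma derD f g t (a b : R) : is_derive t 1 f a -> is_derive t 1 g b ->
  is_derive t 1 (fun u => f u + g u) (a + b).
Proof. by move=> ? ?; exact: is_deriveD. Qed.

Lemma derN f t (a : R) : is_derive t 1 f a -> is_derive t 1 (fun u => - f u) (- a).
Proof. by move=> ?; exact: is_deriveN. Qed.

Lemma derM f g t (a b : R) : is_derive t 1 f a -> is_derive t 1 g b ->
  is_derive t 1 (fun u => f u * g u) (f t * b + g t * a).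
Proof. by move=> ? ?; exact: is_deriveM. Qed.

Lemma derX f n t (a : R) : is_derive t 1 f a ->
  is_derive t 1 (fun u => f u ^+ n) (n%:R * f t ^+ n.-1 * a).
Proof.
move=> ?; have -> : (fun u => f u ^+ n) = f ^+ n by rewrite exprfctE.
exact: is_deriveX.
Qed.

Lemma der_expr n t : is_derive t 1 (fun u : R => u ^+ n) (n%:R * t ^+ n.-1).
Proof. by apply: is_derive_der (@derX id n t 1 (is_derive_id _ _)) _; rewrite mulr1. Qed.

Lemma derC (c : R) t : is_derive t 1 (fun=> c) (0 : R).
Proof. exact: is_derive_cst. Qed.

Lemma derZ (c : R) f t (a : R) : is_derive t 1 f a ->
  is_derive t 1 (fun u => c * f u) (c * a).
Proof. by move=> ?; exact: is_deriveZ. Qed.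

Lemma der_continuous f t (a : R) : is_derive t 1 f a -> {for t, continuous f}.
Proof. by move=> [? _]; exact/differentiable_continuous/derivable1_diffP. Qed.

Lemma der_comp f g t (a b : R) : is_derive (g t) 1 f a -> is_derive t 1 g b ->
  is_derive t 1 (fun u => f (g u)) (a * b).
Proof. by move=> ? ?; exact: is_derive1_comp. Qed.

Lemma der_near f g t (a e : R) : 0 < e ->
  (forall u, `|u - t| < e -> f u = g u) -> is_derive t 1 f a -> is_derive t 1 g a.
Proof.
move=> e0 fg; apply: near_eq_is_derive.
by exists e => //= u; rewrite /= distrC => /fg.
Qed.

(** The quotient-free form is the one that covering and mean value arguments use: it makes sense at
    [u = t] too. *)
Lemma is_deriveP f t (l : R) : is_derive t 1 f l <->
  forall e, 0 < e -> exists2 d, 0 < d &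
    forall u, `|u - t| < d -> `|f u - f t - l * (u - t)| <= e * `|u - t|.
Proof.
split=> [[df lE] e e0|H].
  have /cvgrPdist_le/(_ e e0) : (fun h => h^-1 *: (f (h *: 1 + t) - f t)) @ 0^' --> l.
    by rewrite -lE; exact: df.
  move=> [d /= d0 H]; exists d => // u ut.
  have [->|ut0] := eqVneq u t; first by rewrite !subrr mulr0 subrr normr0 mulr0.
  have nz : u - t != 0 by rewrite subr_eq0.
  have := H (u - t); rewrite /= sub0r normrN => /(_ ut nz).
  rewrite [_%:A]mulr1 subrK => K.
  have -> : f u - f t - l * (u - t) = - (l - (u - t)^-1 *: (f u - f t)) * (u - t).
    by rewrite /GRing.scale /=; field.
  by rewrite normrM normrN ler_wpM2r.
have C : (fun h => h^-1 *: (f (h *: 1 + t) - f t)) @ 0^' --> l.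
  apply/cvgrPdist_le => /= e e0; have [d d0 Hd] := H e e0.
  exists d => //= h; rewrite /= sub0r normrN => hd h0.
  have := Hd (h + t); rewrite addrK => /(_ hd) K.
  rewrite [_%:A]mulr1.
  have -> : l - h^-1 *: (f (h + t) - f t) = - (f (h + t) - f t - l * h) / h.
    by rewrite /GRing.scale /=; field.
  by rewrite normrM normrN normfV ler_pdivrMr ?normr_gt0.
by split; [apply/cvg_ex; exists l|exact: cvg_lim C].
Qed.

Lemma within_itv_continuous f (a b : R) :
  (forall t, a <= t <= b -> {for t, continuous f}) -> {within `[a, b], continuous f}.
Proof.
move=> H; apply: continuous_in_subspaceT => t; rewrite inE /= in_itv /=; exact: H.
Qed.

Lemma der_le f g (df dg : R -> R) (a b : R) : a <= b ->
  {within `[a, b], continuous f} -> {within `[a, b], continuous g} ->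
  (forall t, a < t < b -> [/\ is_derive t 1 f (df t), is_derive t 1 g (dg t) & df t <= dg t]) ->
  f b - f a <= g b - g a.
Proof.
move=> ab cf cg H; rewrite -subr_ge0.
(* [MVT_segment] only places [c] in the closed interval, and nothing is assumed of [df] and [dg] at
   its ends; the value 0 there keeps the sign. *)
have [| |c cab E] := @MVT_segment R (fun t => g t - f t) (fun t => if a < t < b then dg t - df t else 0) _ _ ab.
- move=> t; rewrite in_itv /= => tab; rewrite tab.
  by have [? ? _] := H _ tab; apply: derD => //; exact: derN.
- by move=> t; apply: continuousB; [exact: cg|exact: cf].
- have -> : g b - g a - (f b - f a) = g b - f b - (g a - f a) by ring.
  rewrite E mulr_ge0 ?subr_ge0 //; case: ifPn => // cab'.
  by have [_ _] := H _ cab'; rewrite subr_ge0.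
Qed.

Lemma der_bound f (df : R -> R) (a b M : R) : a <= b ->
  {within `[a, b], continuous f} ->
  (forall t, a < t < b -> is_derive t 1 f (df t) /\ `|df t| <= M) ->
  `|f b - f a| <= M * (b - a).
Proof.
move=> ab cf H.
have cl c : {within `[a, b], continuous (fun t : R => c * t)}.
  by apply: within_itv_continuous => t _; exact: mulrl_continuous.
have dl c t : is_derive t 1 (fun t : R => c * t) c.
  by apply: is_derive_der (derZ c (is_derive_id _ _)) _; rewrite mulr1.
rewrite ler_norml mulrBr; apply/andP; split.
  have -> : - (M * b - M * a) = - M * b - - M * a by ring.
  apply: (@der_le _ _ (fun=> - M) df _ _ ab (cl (- M)) cf) => t /H[dft /ler_normlP[? ?]].
  by split => //; lra.
by apply: (@der_le _ _ df (fun=> M) _ _ ab cf (cl M)) => t /H[dft /ler_normlP[? ?]].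
Qed.

(* The derivative extends to a point across which it has a continuous extension. *)
Lemma der_punctured f (df : R -> R) t (e : R) : 0 < e ->
  (forall u, 0 < `|u - t| < e -> is_derive u 1 f (df u)) ->
  {for t, continuous f} -> {for t, continuous df} -> is_derive t 1 f (df t).
Proof.
move=> e0 H cf cdf; apply/is_deriveP => eps eps0.
have /cvgrPdist_le/(_ _ eps0) [d /= d0 Hd] := cdf.
exists (Num.min d e); first by rewrite lt_min d0.
move=> u; rewrite lt_min => /andP[ud ue].
(* The mean value bound for [f] minus its candidate tangent, on an interval that has [t] at most as
   an end point. *)
have key (a b : R) : a <= b -> (forall s, a < s < b -> 0 < `|s - t| < Num.min d e) ->
    (forall s, a <= s <= b -> {for s, continuous f}) ->
    `|(f b - df t * b) - (f a - df t * a)| <= eps * (b - a).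
  move=> ab Hs Hc; apply: (@der_bound (fun s => f s - df t * s) (fun s => df s - df t) _ _ _ ab).
    apply: within_itv_continuous => s /Hc cs; apply: cvgB => //.
    exact: mulrl_continuous.
  move=> s /Hs; rewrite lt_min => /and3P[s0 sd se]; split.
    apply: derD; first by apply: H; rewrite s0.
    apply: derN; apply: is_derive_der (derZ _ (is_derive_id _ _)) _.
    by rewrite mulr1.
  by rewrite distrC; apply: Hd; rewrite /= distrC.
have cont s : `|s - t| < e -> {for s, continuous f}.
  move=> se; have [->//|/eqP st] := eqVneq s t.
  by apply: der_continuous (H _ _); rewrite normr_gt0 subr_eq0 se andbT; exact/eqP.
have [tu|ut|->] := ltgtP t u; last by rewrite !subrr mulr0 subrr normr0 mulr0.
  have tuE : `|u - t| = u - t by rewrite ger0_norm // subr_ge0 ltW.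
  rewrite tuE in ud ue *.
  have -> : f u - f t - df t * (u - t) = (f u - df t * u) - (f t - df t * t) by ring.
  apply: key => [|s /andP[ts su]|s /andP[ts su]]; first exact: ltW.
    rewrite lt_min gtr0_norm ?subr_gt0 // ts /=.
    by apply/andP; split; lra.
  by apply: cont; rewrite ger0_norm ?subr_ge0//; lra.
have tuE : `|u - t| = t - u by rewrite distrC ger0_norm // subr_ge0 ltW.
rewrite tuE in ud ue *.
have -> : f u - f t - df t * (u - t) = - ((f t - df t * t) - (f u - df t * u)) by ring.
rewrite normrN; apply: key => [|s /andP[ts su]|s /andP[ts su]]; first exact: ltW.
  rewrite lt_min distrC gtr0_norm ?subr_gt0 // su /=.
  by apply/andP; split; lra.
by apply: cont; rewrite distrC ger0_norm ?subr_ge0//; lra.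
Qed.

(** The integral from [a] is differentiated only at points to the right of [a], so the base point
    [base x] moves with [x]. Subtracting the value at 0 removes the dependence on it: by [Z],
    integrals from two bases differ by a constant. *)
Lemma antiderivative f : continuous f ->
  exists F : R -> R, forall t, is_derive t 1 F (f t).
Proof.
move=> cf.
pose I (a x : R) := (\int[@lebesgue_measure R]_(t in [set` `[a, x]]) (f t))%R.
have dI (a x : R) : a < x -> is_derive x 1 (I a) (f x).
  move=> ax; have xx1 : x < x + 1 by rewrite ltrDl.
  have ci : (@lebesgue_measure R).-integrable `[a, x + 1] (EFin \o f).
    apply: continuous_compact_integrable; first exact: segment_compact.
    by apply: continuous_subspaceT.
  have [d1 d2] := continuous_FTC1_closed xx1 ci ax (cf x).
  by apply: (DeriveDef d1); rewrite -derive1E; exact: d2.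
have Z (a b u v : R) : u <= v -> a < u -> b < u -> I a v - I b v = I a u - I b u.
  move=> uv au bu; apply/eqP; rewrite -subr_eq0 -normr_eq0 eq_le normr_ge0 andbT.
  have := @der_bound (fun v => I a v - I b v) (fun=> 0) u v 0 uv; rewrite mul0r; apply.
    apply: within_itv_continuous => w /andP[uw _].
    apply: cvgB; apply: der_continuous; apply: dI;
      [exact: lt_le_trans au uw|exact: lt_le_trans bu uw].
  move=> w /andP[uw _]; rewrite normr0 lexx; split => //.
  rewrite -(subrr (f w)); apply: derD; first exact: dI (lt_trans au uw).
  by apply: derN; exact: dI (lt_trans bu uw).
pose base (x : R) : R := - (`|x| + 1).
have base_lt x : base x < x /\ base x < 0.
  by rewrite /base; split; [have := ler_norm (- x); rewrite normrN|have := normr_ge0 x]; lra.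
exists (fun x => I (base x) x - I (base x) 0) => t.
have [? ?] := base_lt t.
apply: (@der_near (fun x => I (base t - 1) x - I (base t - 1) 0) _ _ _ 1) => //.
  move=> u ut; have [b1 b2] := base_lt u.
  have tu : base t - 1 < u.
    by rewrite /base; move/ltr_normlP: ut => [? ?]; have := ler_norm (- t); rewrite normrN; lra.
  have [u0|/ltW u0] := leP u 0.
    by have := @Z (base u) (base t - 1) u 0 u0; rewrite b1 tu => /(_ isT isT); lra.
  have := @Z (base u) (base t - 1) 0 u u0; rewrite b2 => /(_ isT) E.
  by have := E; lra.
rewrite -[f t]addr0; apply: derD.
by apply: dI; lra.
Qed.

End real_functions.

(** * Absolutely continuous functions *)

Section absolutely_continuous.
Context {R : realType}.
Local Notation mu := (@lebesgue_measure R).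

(** Real induction: the supremum of the [t] with [P a t] is attained and, unless it is [b], passed.
    The local hypothesis concerns only intervals containing [x], as in Cousin's lemma, so [P] may be
    a tagged estimate or an agreement of two solutions. *)
Lemma segment_gluing (P : R -> R -> Prop) (a b : R) : a <= b ->
  (forall s t u, a <= s -> s <= t -> t <= u -> u <= b -> P s t -> P t u -> P s u) ->
  (forall x, a <= x <= b -> exists2 d, 0 < d &
    forall s t, s <= x <= t -> a <= s -> t <= b -> x - d < s -> t < x + d -> P s t) ->
  P a b.
Proof.
move=> ab trP locP; pose S := [set t | a <= t <= b /\ P a t].
have Sa : S a.
  split; first by rewrite lexx.
  have [|d d0 H] := locP a; first by rewrite lexx.
  by apply: H; rewrite ?lexx//; lra.
have Sub : has_ubound S by exists b => t [/andP[]].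
have Ssup : has_sup S by split; [exists a|].
set c := sup S.
have ac : a <= c by exact: ub_le_sup.
have cb : c <= b by apply: ge_sup; [exists a|move=> t [/andP[]]].
have [|d d0 H] := locP c; first by rewrite ac.
have [t [/andP[at_ tb] Pt] ct] := sup_adherent d0 Ssup.
have tc : t <= c by apply: ub_le_sup => //; split => //; rewrite at_.
pose c' := Num.min (c + d / 2) b.
have cc' : c <= c' by rewrite /c' le_min cb andbT; lra.
have c'b : c' <= b by rewrite /c' ge_min lexx orbT.
have Pc' : P a c'.
  apply: (trP a t c') => //; first exact: le_trans cc'.
  by apply: H; rewrite ?tc //; apply: le_lt_trans (_ : c' <= c + d / 2) _; rewrite ?ge_min ?lexx//; lra.
have : c' <= c by apply: ub_le_sup => //; split => //; rewrite (le_trans ac).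
rewrite /c' ge_min => /orP[|bc]; first by move=> K; exfalso; lra.
by move: Pc'; rewrite (_ : c' = b) //; apply/eqP; rewrite eq_le c'b (le_trans bc).
Qed.

Lemma sum_if_ltn (n1 n2 : nat) (F G : nat -> R) :
  \sum_(i < n1 + n2) (if (i < n1)%N then F i else G (i - n1)%N) =
  \sum_(i < n1) F i + \sum_(i < n2) G i.
Proof.
rewrite big_split_ord /=; congr (_ + _); apply: eq_bigr => i _.
  by rewrite ltn_ord.
by rewrite ltnNge leq_addr /= addKn.
Qed.

Lemma negligible_open_cover (N : set R) (e : R) : 0 < e -> mu.-negligible N ->
  exists2 U : set R, open U /\ N `<=` U & (mu U < e%:E)%E.
Proof.
move=> e0 [N' [mN' N'0 NN']].
have [|//|U [oU N'U muU]] := @lebesgue_regularity_outer R N' e mN'; first by apply: (@le_lt_trans _ _ 0%E) => //; rewrite [leLHS]N'0.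
exists U; first by split => //; exact: subset_trans N'U.
have mU : measurable U by exact: measurable_realfun.open_measurable.
rewrite (measureDI mu mU mN') [X in (_ + X)%E](_ : _ = 0%E) ?adde0 //.
apply/eqP; rewrite eq_le measure_ge0 andbT.
apply: (@le_trans _ _ (mu N')); last by rewrite [leLHS]N'0.
by apply: le_measure; rewrite ?inE//; exact: measurableI.
Qed.

(* Cousin's argument: near a point outside [N] the increment of [f] is controlled
   by the derivative; near a point of [N] the interval lies in an open set of small
   measure, and the increments over such intervals are handled by absolute
   continuity. *)
Lemma ac_ae_der_le (f : R -> R) (a b M : R) (N : set R) : a <= b ->
  absolutely_continuous_on a b f -> mu.-negligible N ->
  (forall t, a <= t <= b -> ~ N t -> exists2 v, is_derive t 1 f v & v <= M) ->
  f b - f a <= M * (b - a).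
Proof.
move=> ab acf negN H.
suff key eps : 0 < eps -> f b - f a <= M * (b - a) + eps * (b - a) + eps + `|M| * eps.
  rewrite leNgt; apply/negP => lt.
  (* With this factor the total error in [key] is half the supposed excess
     [f b - f a - M * (b - a)]. *)
  pose c := 2 * (b - a + 1 + `|M|).
  have c0 : 0 < c by rewrite /c; have := normr_ge0 M; lra.
  pose eps := (f b - f a - M * (b - a)) / c.
  have e0 : 0 < eps by rewrite divr_gt0 // subr_gt0.
  have := key _ e0; have : eps * c = f b - f a - M * (b - a) by rewrite /eps divfK // gt_eqF.
  by rewrite /c => E1 E2; nra.
move=> eps0; have [del del0 Hac] := acf _ eps0.
(* The bound [del] serves absolute continuity, the bound [eps] the term [|M|] times the total
   length. *)
have [|U [oU NU] muU] := @negligible_open_cover N (Num.min del eps) _ negN.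
  by rewrite lt_min del0.
have mU : measurable U by exact: measurable_realfun.open_measurable.
(* The intervals [[u i, v i]] are the pieces tagged by a point of [N]. Their length is compared with
   [U] in the half-open [[s, t[], so that the measures of adjacent segments add up. *)
pose good s t := exists n (u v : nat -> R),
  [/\ forall i, (i < n)%N -> [/\ s <= u i, u i <= v i & v i <= t],
      forall i j, (i < j < n)%N -> v i <= u j,
      ((\sum_(i < n) (v i - u i))%:E <= mu (U `&` `[s, t[))%E &
      f t - f s <= (M + eps) * (t - s) + \sum_(i < n) `|f (v i) - f (u i)|
         + `|M| * \sum_(i < n) (v i - u i)].
have : good a b.
  apply: (@segment_gluing good) => //.
    move=> s t u as_ st tu ub [n1 [u1 [v1 [A1 B1 C1 D1]]]] [n2 [u2 [v2 [A2 B2 C2 D2]]]].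
    exists (n1 + n2)%N, (fun i => if (i < n1)%N then u1 i else u2 (i - n1)%N),
      (fun i => if (i < n1)%N then v1 i else v2 (i - n1)%N).
    have E (F : R -> R -> R) : \sum_(i < n1 + n2)
        F (if (i < n1)%N then v1 i else v2 (i - n1)%N) (if (i < n1)%N then u1 i else u2 (i - n1)%N) =
        \sum_(i < n1) F (v1 i) (u1 i) + \sum_(i < n2) F (v2 i) (u2 i).
      rewrite -(sum_if_ltn n1 n2 (fun i => F (v1 i) (u1 i)) (fun i => F (v2 i) (u2 i))).
      by apply: eq_bigr => i _; case: ifP.
    split.
    + move=> i ilt; case: ifPn => [/A1[? ? ?]|]; first by split => //; exact: le_trans tu.
      rewrite -leqNgt => ni; have [|? ? ?] := A2 (i - n1)%N; first by rewrite ltn_subLR.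
      by split => //; exact: le_trans st _.
    + move=> i j /andP[ij jlt]; case: ifPn => iN1; case: ifPn => jN1.
      * by apply: B1; rewrite ij.
      * have [_ _ h1] := A1 _ iN1; have [|h2 _ _] := A2 (j - n1)%N.
          by rewrite ltn_subLR // leqNgt.
        exact: le_trans h1 h2.
      * by exfalso; move: iN1; rewrite (ltn_trans ij).
      * by rewrite -!leqNgt in iN1 jN1; apply: B2; rewrite ltn_sub2r ?ltn_subLR//= (leq_ltn_trans iN1).
    + rewrite (E (fun x y => x - y)) EFinD.
      have -> : U `&` `[s, u[ = (U `&` `[s, t[) `|` (U `&` `[t, u[).
        rewrite -setIUr; congr (_ `&` _); apply/seteqP; split => x /=; rewrite !in_itv /=.
          by move=> /andP[sx xu]; have [xt|xt] := ltP x t; [left|right]; rewrite ?sx.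
        by move=> [/andP[sx xt]|/andP[tx xu]]; apply/andP; split => //;
          [exact: lt_le_trans tu|exact: le_trans tx].
      rewrite measureU; [exact: leeD|exact: measurableI|exact: measurableI|].
      rewrite -subset0 => x [[_ /=]]; rewrite !in_itv /= => /andP[_ xt] [_ /andP[tx _]].
      by move: tx; rewrite leNgt xt.
    + by rewrite (E (fun x y => x - y)) (E (fun x y => `|f x - f y|)); nra.
  move=> x xab; have [Nx|Nx] := pselect (N x).
    have [d /= d0 dU] : nbhs x U by apply: open_nbhs_nbhs; split => //; exact: NU.
    exists d => // s t /andP[sx xt] as_ tb ds td; exists 1%N, (fun=> s), (fun=> t).
    have st : s <= t by exact: le_trans xt.
    split => //.
    + by move=> i j; rewrite ltnS; case: j => // ?; rewrite ltn0 ?andbF.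
    + rewrite big_ord1 setIC (_ : `[s, t[%classic `&` U = `[s, t[%classic).
        by rewrite lebesgue_measure_itv /= lte_fin; case: ltP => // ts; rewrite lee_fin subr_le0.
      apply/seteqP; split => [y []//|y /=]; rewrite in_itv /= => /andP[sy yt].
      split; first by rewrite sy.
      by apply: dU; rewrite /ball /= ltr_distl; apply/andP; split; lra.
    + rewrite !big_ord1; have := ler_norm (f t - f s); have := ler_norm (- M); rewrite normrN.
      by move: (normr_ge0 M) => *; nra.
  have [v /is_deriveP/(_ _ eps0)[d d0 Hd] vM] := H _ xab Nx.
  exists d => // s t /andP[sx xt] as_ tb ds td; exists 0%N, (fun=> s), (fun=> t); split => //.
  - by move=> i j; rewrite ltn0 andbF.
  - by rewrite big_ord0 measure_ge0.
  rewrite !big_ord0 mulr0 !addr0.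
  have /ler_normlP[h1 _] : `|f s - f x - v * (s - x)| <= eps * `|s - x|.
    by apply: Hd; rewrite distrC ger0_norm ?subr_ge0 //; lra.
  have /ler_normlP[_ h2] : `|f t - f x - v * (t - x)| <= eps * `|t - x|.
    by apply: Hd; rewrite ger0_norm ?subr_ge0 //; lra.
  rewrite distrC ger0_norm ?subr_ge0 // in h1.
  rewrite ger0_norm ?subr_ge0 // in h2.
  by nra.
move=> [n [u [v [A B C D]]]].
have len : \sum_(i < n) (v i - u i) < Num.min del eps.
  rewrite -lte_fin; apply: le_lt_trans C _; apply: le_lt_trans muU.
  by apply: le_measure; rewrite ?inE//; apply: measurableI.
move: len; rewrite lt_min => /andP[len1 len2].
have := Hac n u v A B len1; have := ler_wpM2l (normr_ge0 M) (ltW len2).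
by lra.
Qed.

End absolutely_continuous.

(** * Scalar differential equations *)

Section picard.
Context {R : realType}.

Lemma le0_geometric (x K : R) : (forall n, x <= K / 2 ^+ n) -> x <= 0.
Proof.
move=> H; rewrite leNgt; apply/negP => x0.
have K0 : 0 < K by have := H 0%N; rewrite expr0 divr1; exact: lt_le_trans.
have := H (Num.Def.archi_bound (K / x)); set n := Num.Def.archi_bound _.
rewrite ler_pdivlMr ?exprn_gt0 // => H1.
have : K / x < n%:R by apply: archi_boundP; rewrite divr_ge0 // ltW.
rewrite ltr_pdivrMr // => H2.
have : n%:R <= 2 ^+ n :> R by rewrite -natrX ler_nat ltnW // ltn_expl.
move=> H3; have := ler_wpM2l (ltW x0) H3; lra.
Qed.

(** The intervals of radius [2 K / 2 ^+ n] around [v n] are nested; the supremum of their left ends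
    lies in all of them, which gives the limit together with its rate. *)
Lemma geometric_limit (v : nat -> R) (K : R) : 
  (forall n, `|v n.+1 - v n| <= K / 2 ^+ n) ->
  exists l, forall n, `|v n - l| <= 2 * K / 2 ^+ n.
Proof.
move=> H; pose a n := v n - 2 * K / 2 ^+ n; pose b n := v n + 2 * K / 2 ^+ n.
have halve n : 2 * K / 2 ^+ n = K / 2 ^+ n + 2 * K / 2 ^+ n.+1.
  by rewrite exprS; field; rewrite expf_neq0.
have aS n : a n <= a n.+1.
  by rewrite /a [in leLHS]halve; have /ler_normlP[? ?] := H n; lra.
have bS n : b n.+1 <= b n.
  by rewrite /b [in leRHS]halve; have /ler_normlP[? ?] := H n; lra.
have K0 n : 0 <= K / 2 ^+ n by exact: le_trans (H n).
have ab n : a n <= b n by rewrite /a /b -mulrA; have := K0 n; lra.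
have amono n m : (n <= m)%N -> a n <= a m.
  by elim: m => [|m IH]; rewrite leq_eqVlt => /predU1P[->//|]; rewrite ?ltn0// ltnS => /IH/le_trans; apply.
have bmono n m : (n <= m)%N -> b m <= b n.
  by elim: m => [|m IH]; rewrite leq_eqVlt => /predU1P[->//|]; rewrite ?ltn0// ltnS => /IH; apply: le_trans.
have abm n m : a n <= b m.
  apply: le_trans (amono _ _ (leq_maxl n m)) _.
  by apply: le_trans (ab _) (bmono _ _ (leq_maxr n m)).
exists (sup (range a)) => n.
have h1 : a n <= sup (range a).
  by apply: ub_le_sup; [exists (b 0%N) => _ [m _ <-]|exists n].
have h2 : sup (range a) <= b n.
  by apply: ge_sup; [exists (a 0%N); exists 0%N|move=> _ [m _ <-]].
by rewrite ler_norml; move: h1 h2; rewrite /a /b => *; apply/andP; split; lra.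
Qed.

Lemma der_norm_le (f g df dg : R -> R) (a b : R) : a <= b ->
  {within `[a, b], continuous f} -> {within `[a, b], continuous g} ->
  (forall t, a < t < b ->
     [/\ is_derive t 1 f (df t), is_derive t 1 g (dg t) & `|df t| <= dg t]) ->
  `|f b - f a| <= g b - g a.
Proof.
move=> ab cf cg H; rewrite ler_norml; apply/andP; split; last first.
  by apply: (der_le ab cf cg) => t /H[? ? /ler_normlP[? ?]]; split; eauto.
have cNf : {within `[a, b], continuous (fun x => - f x)}.
  by move=> x; apply: continuousN; exact: cf.
have : - f b - - f a <= g b - g a.
  apply: (@der_le _ _ _ (fun t => - df t) dg _ _ ab cNf cg) => t /H[? ? /ler_normlP[? ?]].
  by split; [exact: derN| |lra].
by lra.
Qed.

(** Picard iteration on the whole half-line at once: against the weight [expR (2 L (t - t0))] each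
    step gains a factor 1/2. Continuity of [F] is asked along continuous curves, which is the form
    an antiderivative takes. *)
Lemma picard_lindelof (F : R -> R -> R) (t0 C L M : R) : 0 < L ->
  (forall u : R -> R, continuous u -> continuous (fun t => F t (u t))) ->
  (forall t x y, `|F t x - F t y| <= L * `|x - y|) ->
  (forall t x, `|F t x| <= M) ->
  exists G : R -> R, [/\ continuous G, forall t, t <= t0 -> G t = C &
     forall t : R, t0 < t -> is_derive t 1 G (F t (G t))].
Proof.
move=> L0 cF lipF bF.
have prim (u : R -> R) : exists P : R -> R, P t0 = C /\
    (continuous u -> forall t : R, is_derive t 1 P (F t (u t))).
  have [cu|ncu] := pselect (continuous u); last by exists (fun=> C).
  have [P dP] := antiderivative (cF _ cu).
  exists (fun t => P t + (C - P t0)); split => [|_ t]; first by ring.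
  by apply: is_derive_der (derD (dP t) (derC _ _)) _; rewrite addr0.
(* [Phi] is total; at a discontinuous [u] only [Phi u t0 = C] is known. *)
pose Phi u := projT1 (cid (prim u)).
have Phi0 u : Phi u t0 = C by rewrite /Phi; case: cid => P [].
have dPhi u : continuous u -> forall t : R, is_derive t 1 (Phi u) (F t (u t)).
  by rewrite /Phi; case: cid => P [].
have cPhi u : continuous u -> continuous (Phi u).
  by move=> cu t; apply: der_continuous (dPhi _ cu t).
pose u := fix u n := if n is n'.+1 then Phi (u n') else (fun=> C).
have cu n : continuous (u n) by elim: n => [|n IH] /=; [move=> ?; exact: cst_continuous|exact: cPhi].
have M0 : 0 <= M by exact: le_trans (bF 0 0).
pose E t := expR (2 * L * (t - t0)).
have dE (t : R) : is_derive t 1 E (E t * (2 * L)).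
  apply: (@der_comp _ expR (fun t => 2 * L * (t - t0))).
  by apply: is_derive_der (derZ _ (derD (is_derive_id _ _) (derC _ _))) _; rewrite addr0 mulr1.
have E0 t : 0 <= E t by exact: expR_ge0.
have cE : continuous E by move=> t; apply: der_continuous (dE t).
have E_le s t : s <= t -> E s <= E t by move=> st; rewrite ler_expR; nra.
have Ege t : t0 <= t -> 1 <= E t by move=> tt; have := E_le _ _ tt; rewrite {1}/E subrr mulr0 expR0.
(* Chosen for the first iterate: [M (t - t0) = c (2 L (t - t0)) <= c * E t]. *)
pose c := M / (2 * L).
have c0 : 0 <= c by rewrite divr_ge0 //; lra.
have step n : forall t, t0 <= t -> `|u n.+1 t - u n t| <= c * E t / 2 ^+ n.
  elim: n => [|n IH] t tt.
    rewrite expr0 divr1 /= -{2}(Phi0 (fun=> C)).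
    apply: (@le_trans _ _ (M * (t - t0))).
      apply: (der_bound tt); first by apply: continuous_subspaceT; exact: cPhi (cu 0%N).
      by move=> s _; split; [exact: (dPhi _ (cu 0%N))|exact: bF].
    apply: (@le_trans _ _ (c * (2 * L * (t - t0)))).
      by rewrite /c mulrA divfK // mulf_neq0 // ?gt_eqF //.
    apply: ler_wpM2l => //; rewrite /E; apply: le_trans (expR_ge1Dx _).
    by lra.
  have := @der_norm_le (fun t => u n.+2 t - u n.+1 t) (fun t => c / 2 ^+ n.+1 * E t)
    (fun t => F t (u n.+1 t) - F t (u n t)) (fun t => c / 2 ^+ n.+1 * (E t * (2 * L))) t0 t tt.
  rewrite /= !Phi0 subrr subr0 => /(_ _ _ _)/le_trans; apply.
  - by apply: continuous_subspaceT => s; apply: cvgB; [exact: (cu n.+2)|exact: (cu n.+1)].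
  - by apply: continuous_subspaceT => s; apply: cvgM; [exact: cvg_cst|exact: cE].
  - move=> s /andP[ts st]; split.
    + by apply: derD; [exact: (dPhi _ (cu n.+1))|apply: derN; exact: (dPhi _ (cu n))].
    + exact: derZ.
    + apply: le_trans (lipF _ _ _) _.
      apply: le_trans (ler_wpM2l (ltW L0) (IH _ (ltW ts))) _.
      by rewrite exprS le_eqVlt; apply/orP; left; apply/eqP; field; rewrite expf_neq0.
  - rewrite lerBlDr -[leLHS]addr0 mulrAC lerD ?lexx //.
    rewrite !mulr_ge0 ?invr_ge0 ?exprn_ge0 // ?E0 //. lra.
have /choice[G0 G0P] : forall t, exists l, t0 <= t -> forall n, `|u n t - l| <= 2 * (c * E t) / 2 ^+ n.
  move=> t; have [tt|tt] := leP t0 t; last by exists 0.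
  by have [l Hl] := geometric_limit (fun n => step n t tt); exists l.
(* Freezing time at [t0] makes the limit a function on the whole line, constant on the left, so that
   continuity at [t0] is two-sided. *)
pose m (t : R) := Num.max t t0.
have cm : continuous m by move=> t; apply: continuous_max; [exact: cvg_id|exact: cvg_cst].
have mge t : t0 <= m t by rewrite le_max lexx orbT.
pose G t := G0 (m t).
have GP n t : `|u n (m t) - G t| <= 2 * (c * E (m t)) / 2 ^+ n by apply: G0P.
have GPT n t T : t <= T -> `|u n (m t) - G t| <= 2 * (c * E (m T)) / 2 ^+ n.
  move=> tT; apply: le_trans (GP n t) _; rewrite ler_wpM2r ?invr_ge0 ?exprn_ge0 //.
  by rewrite !ler_wpM2l // E_le // ge_max !le_max tT lexx orbT.
have cG : continuous G.
  move=> t; apply/cvgrPdist_le => /= eps eps0.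
  have [n Hn] : exists n, 2 * (c * E (m (t + 1))) / 2 ^+ n < eps / 3.
    apply: contrapT => /forallNP H; suff : eps / 3 <= 0 by lra.
    apply: (@le0_geometric _ (2 * (c * E (m (t + 1))))) => n.
    by rewrite leNgt; apply/negP; exact: H.
  have eps3 : 0 < eps / 3 by rewrite divr_gt0.
  have cum : {for t, continuous (fun t => u n (m t))}.
    by apply: continuous_comp; [exact: cm|exact: cu].
  have /cvgrPdist_le/(_ _ eps3)[d /= d0 Hd] := cum.
  exists (Num.min d 1); first by rewrite /= lt_min d0 ltr01.
  move=> s; rewrite /= lt_min => /andP[sd s1].
  have h1 := Hd s sd.
  have h2 : `|u n (m t) - G t| < eps / 3.
    by apply: le_lt_trans (GPT n t (t + 1) _) Hn; lra.
  have h3 : `|u n (m s) - G s| < eps / 3.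
    by apply: le_lt_trans (GPT n s (t + 1) _) Hn; move/ltr_normlP : s1 => [? ?]; lra.
  have -> : G t - G s = - (u n (m t) - G t) + (u n (m t) - u n (m s)) + (u n (m s) - G s) by ring.
  apply: le_trans (ler_normD _ _) _; rewrite (_ : eps = eps / 3 + eps / 3 + eps / 3); last by field.
  apply: lerD (ltW h3); apply: le_trans (ler_normD _ _) _.
  by rewrite normrN; apply: lerD h1; exact: ltW.
have fixG t : t0 <= t -> G t = Phi G t.
  move=> tt; apply/eqP; rewrite -subr_eq0 -normr_eq0 eq_le normr_ge0 andbT.
  have mt s : t0 <= s -> m s = s by move=> ts; rewrite /m; apply/max_idPl.
  pose A := 2 * (c * E (m t)).
  have A0 : 0 <= A by apply: mulr_ge0 => //; exact: mulr_ge0.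
  apply: (@le0_geometric _ (A + L * A * (t - t0))) => n.
  have -> : G t - Phi G t = (u n.+1 t - Phi G t) - (u n.+1 t - G t) by ring.
  apply: le_trans (ler_normB _ _) _; rewrite mulrDl addrC; apply: lerD.
    rewrite -{1}(mt t tt); apply: le_trans (GPT _ _ t _) _ => //.
    rewrite -/A; apply: ler_wpM2l => //; rewrite lef_pV2 ?posrE ?exprn_gt0 //.
    by rewrite exprS ler_peMl ?exprn_ge0 // ler1n.
  have := @der_bound _ (fun s => u n.+1 s - Phi G s) (fun s => F s (u n s) - F s (G s))
     t0 t (L * (A / 2 ^+ n)) tt.
  rewrite /= !Phi0 subrr subr0 => /(_ _ _)/le_trans; apply.
  - by apply: continuous_subspaceT => s; apply: cvgB; [exact: (cu n.+1)|exact: cPhi].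
  - move=> s /andP[ts st]; split.
      by apply: derD; [exact: (dPhi _ (cu n))|apply: derN; exact: dPhi].
    apply: le_trans (lipF _ _ _) _; apply: ler_wpM2l; first exact: ltW.
    by rewrite -{1}(mt s (ltW ts)); apply: GPT; exact: ltW.
  - by rewrite le_eqVlt; apply/orP; left; apply/eqP; field; rewrite expf_neq0.
exists G; split => // [t tt|t tt].
  have mt : m t = t0 by rewrite /m; apply/max_idPr.
  have : G t0 = C by rewrite (fixG t0) // Phi0.
  by rewrite /G mt /m maxxx.
apply: (@der_near _ (Phi G) G t _ (t - t0)); rewrite ?subr_gt0 //.
  by move=> s /ltr_normlP[h1 h2]; rewrite fixG //; lra.
exact: dPhi.
Qed.

End picard.

(** * The shooting problem *)

Section profile.
Context {R : realType}.

Definition rsqrt (d : R) : R := (Num.sqrt d)^-1.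

Lemma rsqrt_gt0 d : 0 < d -> 0 < rsqrt d.
Proof. by move=> d0; rewrite invr_gt0 sqrtr_gt0. Qed.

Lemma rsqrt2 d : 0 < d -> rsqrt d ^+ 2 = d^-1.
Proof. by move=> d0; rewrite exprVn sqr_sqrtr // ltW. Qed.

Lemma rsqrt2M d : 0 < d -> rsqrt d ^+ 2 * d = 1.
Proof. by move=> d0; rewrite rsqrt2 // mulVf // gt_eqF. Qed.

Lemma rsqrt_le a b : 0 < a -> a <= b -> rsqrt b <= rsqrt a.
Proof.
move=> a0 ab; have b0 := lt_le_trans a0 ab.
by rewrite lef_pV2 ?posrE ?sqrtr_gt0 // ler_sqrt // ltW.
Qed.

Lemma rsqrt1 : rsqrt 1 = 1.
Proof. by rewrite /rsqrt sqrtr1 invr1. Qed.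

Lemma continuous_rsqrt (d : R) : 0 < d -> {for d, continuous rsqrt}.
Proof.
move=> d0; apply: cvgV; first by rewrite gt_eqF // sqrtr_gt0.
exact: sqrt_continuous.
Qed.

Lemma der_rsqrt (d : R) : 0 < d -> is_derive d 1 rsqrt (- (rsqrt d ^+ 3 / 2)).
Proof.
move=> d0; have sd : Num.sqrt d != 0 by rewrite gt_eqF // sqrtr_gt0.
apply: is_derive_der (is_deriveV sd (is_derive1_sqrt d0)) _.
by rewrite /rsqrt /GRing.scale /=; field.
Qed.

Lemma rsqrt_lipschitz (d a b : R) : 0 < d -> d <= a -> d <= b ->
  `|rsqrt a - rsqrt b| <= rsqrt d ^+ 3 * `|a - b|.
Proof.
move=> d0 da db; have a0 := lt_le_trans d0 da; have b0 := lt_le_trans d0 db.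
rewrite /rsqrt -{2}(sqr_sqrtr (ltW a0)) -{2}(sqr_sqrtr (ltW b0)) subr_sqr.
have us : Num.sqrt d <= Num.sqrt a by rewrite ler_sqrt // ltW.
have ut : Num.sqrt d <= Num.sqrt b by rewrite ler_sqrt // ltW.
have u0 : 0 < Num.sqrt d by rewrite sqrtr_gt0.
move: (Num.sqrt a) (Num.sqrt b) (Num.sqrt d) us ut u0 => s t u us ut u0.
have s0 := lt_le_trans u0 us; have t0 := lt_le_trans u0 ut.
have -> : s^-1 - t^-1 = - (s - t) / (s * t) by field; rewrite !gt_eqF.
rewrite exprVn normrM normrN [leRHS]mulrC normrM -mulrA ler_wpM2l //.
have -> : `|(s * t)^-1| = (s * t)^-1 by rewrite ger0_norm // invr_ge0 ltW // mulr_gt0.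
have -> : `|s + t| = s + t by rewrite ger0_norm // addr_ge0 // ltW.
rewrite ler_pdivlMr ?exprn_gt0 // mulrC ler_pdivrMr ?mulr_gt0 //.
apply: (@le_trans _ _ (u * (s * t))).
  by rewrite exprS ler_wpM2l ?expr2 ?ler_pM // ltW.
by rewrite ler_wpM2r ?mulr_ge0 // ?ltW //; lra.
Qed.

Lemma expr_lipschitz (K x y : R) n : 0 <= x <= K -> 0 <= y <= K ->
  `|x ^+ n.+1 - y ^+ n.+1| <= n.+1%:R * K ^+ n * `|x - y|.
Proof.
move=> /andP[x0 xK] /andP[y0 yK]; have K0 := le_trans x0 xK.
elim: n => [|n IH]; first by rewrite !expr1 expr0 mulr1 mul1r.
have -> : x ^+ n.+2 - y ^+ n.+2 = x ^+ n.+1 * (x - y) + y * (x ^+ n.+1 - y ^+ n.+1).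
  by rewrite !exprS; ring.
apply: le_trans (ler_normD _ _) _; rewrite !normrM.
have -> : n.+2%:R * K ^+ n.+1 * `|x - y| = K ^+ n.+1 * `|x - y| + K * (n.+1%:R * K ^+ n * `|x - y|).
  by rewrite -[n.+2%:R]natr1 [K ^+ n.+1]exprS; ring.
apply: lerD.
  by apply: ler_wpM2r => //; rewrite ger0_norm ?exprn_ge0 // lerXn2r // nnegrE.
by apply: ler_pM => //; rewrite ger0_norm.
Qed.

(* [denom] is the quantity D of the header, extended by 1 outside [-1, 1]. *)
Definition denom (t g : R) : R := 1 + (g - 1) * Num.max 0 (1 - t ^+ 2).

Lemma denomE (t g : R) : -1 <= t <= 1 -> denom t g = t ^+ 2 + g * (1 - t ^+ 2).
Proof. by move=> /andP[? ?]; rewrite /denom (max_idPr _); [ring|nra]. Qed.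

Lemma continuous_denom (u : R -> R) : continuous u -> continuous (fun t => denom t (u t)).
Proof.
move=> cu t; apply: cvgD; first exact: cvg_cst.
apply: cvgM; first by apply: cvgB; [exact: cu|exact: cvg_cst].
apply: (@continuous_max R R (fun=> 0) (fun t => 1 - t ^+ 2)); first exact: cvg_cst.
by apply: cvgB; [exact: cvg_cst|exact: exprn_continuous].
Qed.

Lemma denom_le (t g h : R) : g <= h -> denom t g <= denom t h.
Proof.
by move=> gh; rewrite /denom lerD2l ler_wpM2r ?le_max ?lexx // lerD2r.
Qed.

Variable p : nat.
Local Notation beta := (2 / (2 * p.+1%:R + 1) : R).

(** With [q = p + 1], the odd power of [rsqrt] is [D^(-q - 1/2)], free of real exponents. *)
Definition profile_field (t g : R) : R :=
  2 * beta * (1 - t ^+ 2) ^+ p * rsqrt (denom t g) ^+ (2 * p.+1).+1.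

Definition profile (G : R -> R) : Prop :=
  [/\ continuous G, forall t : R, -1 <= t <= 1 -> 0 < denom t (G t) &
      forall t : R, -1 < t < 1 -> is_derive t 1 G (profile_field t (G t))].

Lemma beta_gt0 : 0 < beta.
Proof. by rewrite divr_gt0 // ltr_wpDl // mulr_ge0. Qed.

Lemma profile_coef_ge0 (t : R) : -1 <= t <= 1 -> 0 <= 2 * beta * (1 - t ^+ 2) ^+ p.
Proof.
move=> /andP[t1 t2]; apply: mulr_ge0; last by apply: exprn_ge0; nra.
by apply: mulr_ge0 => //; exact: ltW beta_gt0.
Qed.

Lemma profile_field_ge0 (t g : R) : -1 <= t <= 1 -> 0 < denom t g -> 0 <= profile_field t g.
Proof.
move=> t1 d0; apply: mulr_ge0; first exact: profile_coef_ge0.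
exact/exprn_ge0/ltW/rsqrt_gt0.
Qed.

Lemma profile_field_le (t g h : R) : -1 <= t <= 1 -> 0 < denom t g ->
  g <= h -> profile_field t h <= profile_field t g.
Proof.
move=> t1 d0 gh; apply: ler_wpM2l; first exact: profile_coef_ge0.
have d1 := lt_le_trans d0 (denom_le t gh).
apply: lerXn2r; rewrite ?nnegrE; [exact/ltW/rsqrt_gt0..|].
by apply: rsqrt_le => //; exact: denom_le.
Qed.

(** The derivative of [(G - H) ^+ 2] is [2 (G - H)] times a difference of fields, which has the
    opposite sign. *)
Lemma profile_contract (G H : R -> R) (a b : R) : profile G -> profile H ->
  -1 <= a -> a <= b -> b <= 1 -> `|G b - H b| <= `|G a - H a|.
Proof.
move=> [cG pG dG] [cH pH dH] a1 ab b1; rewrite -ler_sqr ?nnegrE // !real_normK ?num_real //.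
have := @der_le R (fun t => (G t - H t) ^+ 2) (fun=> 0)
  (fun t => 2%:R * (G t - H t) ^+ 1 * (profile_field t (G t) - profile_field t (H t))) (fun=> 0) a b ab.
rewrite subrr subr_le0; apply.
- apply: continuous_subspaceT => t; apply: (@continuous_comp _ _ _ (fun t => G t - H t) (fun x => x ^+ 2)).
    by apply: cvgB; [exact: cG|exact: cH].
  exact: exprn_continuous.
- by apply: continuous_subspaceT => t; exact: cvg_cst.
move=> t /andP[at_ tb]; have t1 : -1 < t < 1 by rewrite (le_lt_trans a1) // (lt_le_trans tb).
have t1' : -1 <= t <= 1 by case/andP: t1 => ? ?; rewrite !ltW.
split; [|exact: derC|].
  by apply: derX; apply: derD; [exact: dG|apply: derN; exact: dH].
rewrite expr1 -mulrA mulr_ge0_le0 //.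
have [gh|/ltW hg] := leP (G t) (H t).
  by have := profile_field_le t1' (pG _ t1') gh => ?; rewrite mulr_le0_ge0 ?subr_le0 ?subr_ge0.
by have := profile_field_le t1' (pH _ t1') hg => ?; rewrite mulr_ge0_le0 ?subr_le0 ?subr_ge0.
Qed.

(** If the order flipped, the graphs would cross at some [c], and contraction from [c] on would
    force [G 1 = H 1]. *)
Lemma profile_mono (G H : R -> R) : profile G -> profile H ->
  G (-1) <= H (-1) -> G 1 <= H 1.
Proof.
move=> pG pH le1; rewrite leNgt; apply/negP => lt.
have [cG _ _] := pG; have [cH _ _] := pH.
have N11 : -1 <= 1 :> R by lra.
have [||c] := @IVT R (fun t => G t - H t) (-1) 1 0 N11.
- by apply: continuous_subspaceT => t; apply: cvgB; [exact: cG|exact: cH].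
- by rewrite ge_min le_max subr_le0 le1 /= !subr_ge0 (ltW lt) orbT.
rewrite in_itv /= => /andP[c1 c2] Ec.
have := profile_contract pG pH c1 c2 (lexx 1); rewrite Ec normr0 normr_le0 subr_eq0 => /eqP E.
by move: lt; rewrite E ltxx.
Qed.

Lemma profile_nondecreasing (G : R -> R) (a b : R) : profile G ->
  -1 <= a -> a <= b -> b <= 1 -> G a <= G b.
Proof.
move=> [cG pG dG] a1 ab b1.
have := @der_le R (fun=> 0) G (fun=> 0) (fun t => profile_field t (G t)) a b ab.
rewrite subrr subr_ge0; apply.
- by apply: continuous_subspaceT => t; exact: cvg_cst.
- exact: continuous_subspaceT.
move=> t /andP[at_ tb]; have t1 : -1 < t < 1 by rewrite (le_lt_trans a1) // (lt_le_trans tb).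
have t1' : -1 <= t <= 1 by case/andP: t1 => ? ?; rewrite !ltW.
split; [exact: derC|exact: dG|exact: profile_field_ge0 (pG _ _)].
Qed.

End profile.

(** * Existence of profiles and the shooting argument *)

Section profile_existence.
Context {R : realType}.
Variable p : nat.
Local Notation beta := (2 / (2 * p.+1%:R + 1) : R).

(** Picard iteration is applied to the field with [denom] cut off below at [del] and [1 - t ^+ 2]
    cut off at 0, which is bounded and globally Lipschitz. By [dlow] the cut-off of [denom] is never
    active on [[-1, 1]]. *)
Lemma profile_exists (B : R) : 0 <= B ->
  exists2 G : R -> R, profile p G & G (-1) = - B.
Proof.
move=> B0; set n := (2 * p.+1).+1.
have b0 : 0 < beta := beta_gt0 p; have b1 : beta <= 1.
  have ? : 1 <= p.+1%:R :> R by rewrite ler1n.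
  by rewrite ler_pdivrMr; lra.
(* The constants [c] and [del] serve the argument at a minimum [m] of [denom]. There [c * e m >= 1]
   and [2 m (1 - G m) >= - c], while [del] is such that [e m * F m (G m) >= 2 c (c * e m)^(p + 1) >=
   2 c]. *)
have [c cE] : exists c : R, c = 2 * (1 + B) by exists (2 * (1 + B)).
have c0 : 0 < c by lra.
pose del : R := beta / c ^+ p.+2.
have del0 : 0 < del by rewrite divr_gt0 // exprn_gt0.
have del1 : del <= 1 / 2.
  rewrite ler_pdivrMr ?exprn_gt0 //.
  apply: (@le_trans _ _ (1 / 2 * 2 ^+ p.+2)); last first.
    by apply: ler_wpM2l; [lra|apply: lerXn2r; rewrite ?nnegrE; lra].
  rewrite exprS mulrA divfK // mul1r; apply: le_trans b1 _.
  by rewrite exprn_ege1 // ler1n.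
pose e (t : R) := Num.max 0 (1 - t ^+ 2).
have e0 t : 0 <= e t by rewrite le_max lexx.
have e1 t : e t <= 1 by rewrite ge_max ler01 /=; have := sqr_ge0 t; lra.
have ce : continuous e.
  move=> t; apply: (@continuous_max R R (fun=> 0) (fun t => 1 - t ^+ 2)); first exact: cvg_cst.
  by apply: cvgB; [exact: cvg_cst|exact: exprn_continuous].
pose K := rsqrt del.
have K0 : 0 < K by exact: rsqrt_gt0.
pose F (t g : R) := 2 * beta * e t ^+ p * rsqrt (Num.max (denom t g) del) ^+ n.
have rK (x : R) : 0 <= rsqrt (Num.max x del) <= K.
  have dm : del <= Num.max x del by rewrite le_max lexx orbT.
  by rewrite rsqrt_le // andbT ltW // rsqrt_gt0 // (lt_le_trans del0).
have coef t : 0 <= 2 * beta * e t ^+ p <= 2 * beta.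
  have ? : 0 <= e t ^+ p by rewrite exprn_ge0.
  have ? : e t ^+ p <= 1 by rewrite exprn_ile1.
  by apply/andP; split; nra.
have cF (u : R -> R) : continuous u -> continuous (fun t => F t (u t)).
  move=> cu t; apply: cvgM.
    apply: cvgM; first exact: cvg_cst.
    by apply: (@continuous_comp _ _ _ e (fun x => x ^+ p)); [exact: ce|exact: exprn_continuous].
  apply: (@continuous_comp _ _ _ (fun t => rsqrt (Num.max (denom t (u t)) del)) (fun x => x ^+ n));
    last exact: exprn_continuous.
  apply: (@continuous_comp _ _ _ (fun t => Num.max (denom t (u t)) del) rsqrt).
    by apply: continuous_max; [exact: continuous_denom|exact: cvg_cst].
  by apply: continuous_rsqrt; rewrite lt_max del0 orbT.
have denomB (t x y : R) : `|denom t x - denom t y| <= `|x - y|.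
  have -> : denom t x - denom t y = (x - y) * e t by rewrite /denom /e; ring.
  by rewrite normrM [`|e t|]ger0_norm // ler_piMr.
have maxB (x y : R) : `|Num.max x del - Num.max y del| <= `|x - y|.
  rewrite !maxEle; case: ifPn => h1; case: ifPn => h2; rewrite -?ltNge in h1 h2 *.
  - by rewrite subrr normr0.
  - by rewrite ler0_norm ?ler0_norm; lra.
  - by rewrite ger0_norm ?ger0_norm; lra.
  - by [].
pose L := 2 * beta * (n%:R * K ^+ n.-1 * K ^+ 3).
have L0 : 0 < L.
  by rewrite /L !mulr_gt0 ?exprn_gt0 // ?ltr0n // invr_gt0 ltr_wpDl // mulr_ge0.
have lipF (t x y : R) : `|F t x - F t y| <= L * `|x - y|.
  rewrite -mulrBr normrM; have /andP[cf0 cf1] := coef t.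
  rewrite ger0_norm // /L -[leRHS]mulrA; apply: ler_pM => //.
  apply: le_trans (@expr_lipschitz R K _ _ (2 * p.+1) (rK _) (rK _)) _; rewrite -[leRHS]mulrA.
  apply: ler_wpM2l; first by rewrite mulr_ge0 // exprn_ge0 // ltW.
  apply: le_trans (rsqrt_lipschitz del0 _ _) _; rewrite ?le_max ?lexx ?orbT //.
  apply: ler_wpM2l; first by rewrite exprn_ge0 // ltW.
  exact: le_trans (maxB _ _) (denomB _ _ _).
have bF (t x : R) : `|F t x| <= 2 * beta * K ^+ n.
  have /andP[cf0 cf1] := coef t; have /andP[r0 r1] := rK (denom t x).
  rewrite ger0_norm; last by rewrite mulr_ge0 // exprn_ge0.
  by apply: ler_pM => //; rewrite ?exprn_ge0 // lerXn2r // nnegrE // ltW.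
have [G [cG GC dG]] := picard_lindelof (-1) (- B) L0 cF lipF bF.
have F0 (t x : R) : 0 <= F t x.
  have /andP[cf0 cf1] := coef t; have /andP[r0 r1] := rK (denom t x).
  by rewrite mulr_ge0 // exprn_ge0.
have GB t : -1 <= t -> - B <= G t.
  move=> t1; rewrite -(GC (-1)) ?lexx // -subr_ge0.
  have := @der_le R (fun=> 0) G (fun=> 0) (fun t => F t (G t)) (-1) t t1.
  rewrite subrr; apply.
  - by apply: continuous_subspaceT => s; exact: cvg_cst.
  - exact: continuous_subspaceT.
  - by move=> s /andP[s1 _]; split; [exact: derC|exact: dG|exact: F0].
have N11 : -1 <= 1 :> R by lra.
have eE (t : R) : -1 <= t <= 1 -> e t = 1 - t ^+ 2.
  by move=> /andP[? ?]; rewrite /e (max_idPr _) //; nra.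
(* At an interior minimum with [denom < del] the derivative of [denom] would be positive. *)
have dlow (t : R) : -1 <= t <= 1 -> del <= denom t (G t).
  have [|m] := @EVT_min R (fun t => denom t (G t)) (-1) 1 N11.
    by apply: continuous_subspaceT; exact: continuous_denom.
  rewrite in_itv /= => m1 mmin t1.
  apply: le_trans (mmin t _); last by rewrite in_itv.
  rewrite leNgt; apply/negP => lt.
  (* At both ends [denom] is 1, which exceeds [del]; so the minimum is interior. *)
  have em : 0 < e m.
    rewrite lt_neqAle e0 andbT; apply/eqP => e00.
    by move: lt; rewrite /denom -/(e m) -e00 mulr0 addr0; lra.
  have m1' : m \in `]-1, 1[.
    by move: em; rewrite eE // in_itv /=; case/andP: m1 => ? ?; nra.
  have m1'' : -1 < m < 1 by rewrite in_itv in m1'.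
  have dm (s : R) : -1 < s < 1 -> is_derive s 1 (fun t => denom t (G t)) (2 * s * (1 - G s) + (1 - s ^+ 2) * F s (G s)).
    move=> /andP[s1 s2].
    apply: (@der_near _ (fun t => t ^+ 2 + G t * (1 - t ^+ 2)) _ _ _ (Num.min (1 - s) (1 + s))).
    - by rewrite lt_min; apply/andP; split; lra.
    - move=> u; rewrite lt_min => /andP[/ltr_normlP[? ?] /ltr_normlP[? ?]].
      by rewrite denomE //; apply/andP; split; lra.
    apply: is_derive_der (derD (der_expr 2 s)
      (derM (dG _ s1) (derD (derC 1 s) (derN (der_expr 2 s))))) _.
    by rewrite /=; ring.
  have [dm1 dm2] : is_derive m 1 (fun t => denom t (G t)) 0.
    apply: derive1_at_min m1' _ => // [s|s]; rewrite in_itv /= => s1.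
      by case: (dm s s1).
    by apply: mmin; rewrite in_itv /=; case/andP: s1 => *; rewrite !ltW.
  have [_ dm2'] := dm m m1''.
  have := dm2'; rewrite dm2 -(eE m m1) => E0.
  have GmB := GB m (proj1 (andP m1)).
  have lt' : 1 + (G m - 1) * e m < del := lt.
  have g1 : G m < 1 by nra.
  have ce1 : 1 <= c * e m by nra.
  have Fm : F m (G m) = 2 * beta * e m ^+ p * K ^+ n by rewrite /F max_r // ltW.
  have K1 : 1 <= K by rewrite -rsqrt1; apply: rsqrt_le => //; lra.
  have Kn : del^-1 <= K ^+ n.
    rewrite -(rsqrt2 del0) -/K /n mulnS !addSn add0n -[K ^+ 2]mulr1 -(addn2 (2 * p).+1) addnC exprD.
    by apply: ler_wpM2l; [rewrite exprn_ge0 // ltW|exact: exprn_ege1].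
  have : 2 * c <= e m * F m (G m).
    rewrite Fm; apply: (@le_trans _ _ (e m * (2 * beta * e m ^+ p * del^-1))); last first.
      by apply: ler_wpM2l => //; apply: ler_wpM2l => //; case/andP: (coef m).
    have -> : e m * (2 * beta * e m ^+ p * del^-1) = 2 * c * (c * e m) ^+ p.+1.
      rewrite /del invf_div exprMn !exprS; field.
      by rewrite gt_eqF //= gt_eqF // ltr_wpDl // mulr_ge0.
    by rewrite ler_peMr ?exprn_ege1 // mulr_ge0 // ltW.
  by case/andP: m1 => *; nra.
exists G; last by rewrite GC.
split => // t t1; first exact: lt_le_trans del0 (dlow t t1).
have t1' : -1 <= t <= 1 by case/andP: t1 => *; rewrite !ltW.
have /andP[t1'' _] := t1.
rewrite /profile_field -eE // (_ : rsqrt _ = rsqrt (Num.max (denom t (G t)) del)); first exact: dG.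
by rewrite max_l // dlow.
Qed.

(* Shooting: [C |-> G(1)], over the profiles with [G(-1) = C], is nondecreasing and
   nonexpansive. *)
Lemma odd_profile : exists2 G : R -> R, profile p G & G 1 = - G (-1).
Proof.
(* [profile_exists] starts from nonpositive values; the clamp makes [S] total, and [P] continuous on
   the whole line. *)
have /choice[S SP] : forall C : R, exists G : R -> R, profile p G /\ G (-1) = Num.min C 0.
  move=> C; have [|G pG GC] := @profile_exists (- Num.min C 0).
    by rewrite oppr_ge0 ge_min lexx orbT.
  by exists G; rewrite GC opprK.
have N11 : -1 <= 1 :> R by lra.
pose P C := S C 1.
have minE (C : R) : C <= 0 -> Num.min C 0 = C by move=> ?; exact/min_idPl.
have P0 : 0 <= P 0.
  have [pS E] := SP 0; rewrite /P -[X in X <= _](_ : S 0 (-1) = 0); last by rewrite E minxx.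
  exact: profile_nondecreasing pS _ _ _.
have cP : continuous P.
  move=> C; apply/cvgrPdist_le => /= eps eps0; exists eps => //= C'; rewrite /= => CC'.
  have [pS E] := SP C; have [pS' E'] := SP C'.
  apply: le_trans (profile_contract pS pS' (lexx _) N11 (lexx _)) _.
  rewrite E E'; apply: le_trans (ltW CC').
  rewrite !minEle; case: ifPn => h1; case: ifPn => h2; rewrite -?ltNge in h1 h2 *.
  - by [].
  - by rewrite ler0_norm ?ler0_norm; lra.
  - by rewrite ger0_norm ?ger0_norm; lra.
  - by rewrite subrr normr0.
have NP0 : - P 0 <= 0 by rewrite oppr_le0.
(* At [0] the sum is [P 0 >= 0]; at [- P 0] it is [P (- P 0) - P 0], nonpositive by monotonicity. *)
have [||C] := @IVT R (fun C => C + P C) (- P 0) 0 0 NP0.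
- by apply: continuous_subspaceT => C; apply: cvgD; [exact: cvg_id|exact: cP].
- rewrite ge_min le_max; apply/andP; split; last by rewrite add0r P0 orbT.
  rewrite addrC subr_le0; apply/orP; left.
  have [pS E] := SP 0; have [pS' E'] := SP (- P 0).
  by apply: profile_mono pS' pS _; rewrite E E' minxx minE.
rewrite in_itv /= => /andP[_ C0] CP; have [pS E] := SP C.
by exists (S C) => //; rewrite E minE //; apply/eqP; rewrite -addr_eq0 addrC CP.
Qed.

End profile_existence.

(** * From the scalar equation to the system *)

Section coordinates.
Context {R : realType}.
Variable p : nat.
Local Notation Q := (p.+1%:R : R).
Local Notation beta := (2 / (2 * p.+1%:R + 1) : R).

(* In the sequel [q] is [p.+1], and [velocity] and [acceleration] recover [y] and [z]
   from the coordinates [(x, Y, g)]. *)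
Definition velocity (x Y : R) : R := Y - beta * (x * `|x| ^+ p.+1).

Definition acceleration (x Y g : R) : R :=
  - (g / 2) - (1 + beta) * (`|x| ^+ p.+1 * velocity x Y)
  - beta ^+ 2 / 2 * (x * `|x| ^+ p.+1 ^+ 2).

(** The coefficient is [k / q]: differentiating the added term yields [k |x|^q y^2 / x], which
    cancels the singular term of [z'], and what remains is [(k - q) / q = 1 / q] times [|x|^q z]. *)
Definition regular_acceleration (x y z : R) : R :=
  z + p.+2%:R / p.+1%:R * (`|x| ^+ p.+1 * y).

(* [z] itself is not assumed differentiable: for [q = 1] it has corners at [x = 0]. *)
Definition regular_solution (I : set R) (x y z : R -> R) : Prop := forall t, I t ->
  [/\ is_derive t 1 x (y t), is_derive t 1 y (z t) &
      is_derive t 1 (fun t => regular_acceleration (x t) (y t) (z t))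
        (`|x t| ^+ p.+1 * z t / p.+1%:R)].

Lemma der_norm_gt0 (f : R -> R) (t a : R) : 0 < f t -> is_derive t 1 f a ->
  is_derive t 1 (fun u => `|f u|) a.
Proof.
move=> ft df; have /cvgrPdist_lt/(_ _ ft)[d /= d0 Hd] := der_continuous df.
apply: der_near d0 _ df => u ut.
have /Hd/ltr_normlP[h1 h2] : `|t - u| < d by rewrite distrC.
rewrite gtr0_norm //; lra.
Qed.

(** [W] is the derivative of the time of the system with respect to the parameter [t]; it stays
    arbitrary, since every derivative is proportional to it. *)
Lemma der_coordinates (x Y g : R -> R) (t W : R) : 0 < x t ->
  x t * g t + Y t ^+ 2 = 1 ->
  is_derive t 1 x (W * velocity (x t) (Y t)) ->
  is_derive t 1 Y (W * (- (g t / 2) - beta / 2 * (`|x t| ^+ p.+1 * Y t))) ->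
  is_derive t 1 g (W * (beta * x t ^+ p)) ->
  let y t := velocity (x t) (Y t) in
  let z t := acceleration (x t) (Y t) (g t) in
  is_derive t 1 y (W * z t) /\
  is_derive t 1 (fun t => regular_acceleration (x t) (y t) (z t))
     (W * (`|x t| ^+ p.+1 * z t / p.+1%:R)).
Proof.
move=> x0 K1 dx dY dg y z.
have p0 : 0 <= p%:R :> R by [].
(* Writing the energy level 1 as [x g + Y^2] turns the claims below into identities that hold on all
   levels, within reach of [field]. *)
have {}dg : is_derive t 1 g (W * (beta * x t ^+ p * (x t * g t + Y t ^+ 2))).
  by rewrite K1 mulr1.
have dn := der_norm_gt0 x0 dx.
have du := derX p.+1 dn.
have dy : is_derive t 1 y (W * z t).
  apply: is_derive_der (derD dY (derN (derZ beta (derM dx du)))) _.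
  rewrite /z /acceleration /velocity (gtr0_norm x0) /= exprS; field.
  by rewrite gt_eqF //; lra.
have dz := derD (derD (derN (derZ (2^-1) dg)) (derN (derZ (1 + beta) (derM du dy))))
  (derN (derZ (beta ^+ 2 / 2) (derM dx (derX 2 du)))).
split => //.
apply: (@der_near _ (fun t => (- (2^-1 * g t) - (1 + beta) * (`|x t| ^+ p.+1 * y t) - beta ^+ 2 / 2 * (x t * `|x t| ^+ p.+1 ^+ 2)) + p.+2%:R / p.+1%:R * (`|x t| ^+ p.+1 * y t)) _ _ _ 1) => //.
  move=> u _; rewrite /regular_acceleration /z /acceleration /y; field.
  by rewrite !gt_eqF //; lra.
apply: is_derive_der (derD dz (derZ (p.+2%:R / p.+1%:R) (derM du dy))) _.
rewrite /z /acceleration /y /velocity (gtr0_norm x0) /= (exprS (x t) p); field.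
by rewrite !gt_eqF //; lra.
Qed.

Variable G : R -> R.
Hypothesis pG : profile p G.

Local Notation D t := (denom t (G t)).
Local Notation r t := (rsqrt (D t)).

(** The factor [W = 2 D^(-3/2)] is positive, so [t] increases with time: the arc enters [0 < x] at
    [t = -1], with [Y = 1], and leaves at [t = 1], with [Y = -1]. *)
Lemma half_orbit_der (t : R) : -1 < t < 1 ->
  let x t := (1 - t ^+ 2) * r t ^+ 2 in
  let Y t := - t * r t in
  let y t := velocity (x t) (Y t) in
  let z t := acceleration (x t) (Y t) (G t) in
  let W := 2 * r t ^+ 3 in
  [/\ is_derive t 1 x (W * y t), is_derive t 1 y (W * z t) &
  is_derive t 1 (fun t => regular_acceleration (x t) (y t) (z t))
     (W * (`|x t| ^+ p.+1 * z t / p.+1%:R))].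
Proof.
move=> t1 x Y y z W; have [cG pos dG] := pG.
have p0 : 0 <= p%:R :> R by [].
have t1' : -1 <= t <= 1 by case/andP: t1 => *; rewrite !ltW.
have D0 := pos t t1'.
have r0 : 0 < r t := rsqrt_gt0 D0.
have r2 : r t ^+ 2 * (t ^+ 2 + G t * (1 - t ^+ 2)) = 1 by rewrite -denomE // rsqrt2M.
have x0 : 0 < x t.
  by rewrite mulr_gt0 ?exprn_gt0 //; case/andP: t1 => *; nra.
have dD : is_derive t 1 (fun t => D t) (2 * t * (1 - G t) + (1 - t ^+ 2) * profile_field p t (G t)).
  apply: (@der_near _ (fun t => t ^+ 2 + G t * (1 - t ^+ 2)) _ _ _ (Num.min (1 - t) (1 + t))).
  - by case/andP: t1 => *; rewrite lt_min; apply/andP; split; lra.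
  - move=> u; rewrite lt_min => /andP[/ltr_normlP[? ?] /ltr_normlP[? ?]].
    by rewrite denomE //; apply/andP; split; lra.
  apply: is_derive_der (derD (der_expr 2 t)
      (derM (dG _ t1) (derD (derC 1 t) (derN (der_expr 2 t))))) _.
  by rewrite /=; ring.
have dr : is_derive t 1 (fun t => r t) _ := @der_comp R rsqrt (fun t => D t) t _ _ (der_rsqrt D0) dD.
have fieldE : profile_field p t (G t) = 2 * beta * (x t ^+ p * r t ^+ 3).
  have E : (2 * p.+1).+1 = (2 * p + 3)%N by rewrite mulnS addnC -addnS.
  by rewrite /profile_field /x E exprD exprMn -exprM; ring.
have xE : x t = (1 - t ^+ 2) * r t ^+ 2 by [].
have YE : Y t = - t * r t by [].
have Kt : x t * G t + Y t ^+ 2 = 1 by rewrite -r2 xE YE; ring.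
have dx : is_derive t 1 x (W * velocity (x t) (Y t)).
  apply: is_derive_der (derM (derD (derC 1 t) (derN (der_expr 2 t))) (derX 2 dr)) _.
  rewrite fieldE /velocity (gtr0_norm x0) /= /W YE (exprS (x t) p).
  move: (x t ^+ p) => X; rewrite xE; apply/eqP; rewrite -subr_eq0; apply/eqP.
  (* The two sides agree only modulo [r^2 D = 1]; this is the explicit multiple of [1 - r^2 D] by
     which they differ. *)
  transitivity (- 2 * t * r t ^+ 2 * (1 - r t ^+ 2 * (t ^+ 2 + G t * (1 - t ^+ 2)))); last by rewrite r2 subrr mulr0.
  by field; rewrite gt_eqF //; lra.
have dY : is_derive t 1 Y (W * (- (G t / 2) - beta / 2 * (`|x t| ^+ p.+1 * Y t))).
  apply: is_derive_der (derM (derN (is_derive_id t 1)) dr) _.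
  rewrite fieldE (gtr0_norm x0) /= /W YE (exprS (x t) p).
  move: (x t ^+ p) => X; rewrite xE; apply/eqP; rewrite -subr_eq0; apply/eqP.
  transitivity (- r t * (1 - r t ^+ 2 * (t ^+ 2 + G t * (1 - t ^+ 2)))); last by rewrite r2 subrr mulr0.
  by field; rewrite gt_eqF //; lra.
have dG' : is_derive t 1 G (W * (beta * x t ^+ p)).
  by apply: is_derive_der (dG _ t1) _; rewrite fieldE /W; ring.
by have [dy dz] := der_coordinates x0 Kt dx dY dG'; split.
Qed.

End coordinates.

(** * The arc and its opposite, parametrized by the unit circle *)

Section circle_orbit.
Context {R : realType}.
Variable p : nat.
Variable G : R -> R.

(** Over the same [b] the profile is [G (- b)] on one arc and [- G b] on the opposite one.
    [profile_odd] is their mean and [profile_even] half their difference, which vanishes at [b = 1]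
    and [b = -1] by the closing condition. *)
Definition profile_even (b : R) : R := (G (- b) + G b) / 2.
Definition profile_odd (b : R) : R := (G (- b) - G b) / 2.
Definition profile_jump (a : R) : R := profile_even (Num.sqrt (1 - a ^+ 2)).

(* On the unit circle this is [G (- b)] for [0 <= a] and [- G b] for [a <= 0]; the
   formula is one that makes joint continuity manifest. *)
Definition circle_profile (a b : R) : R :=
  profile_odd b + profile_jump (Num.max a 0) - profile_jump (Num.max (- a) 0).

(** The signed square [a |a|] replaces [1 - t^2]: it carries the sign of [x], so that the symmetry
    [v |-> - v] becomes the antipodal map of the circle. *)
Definition circle_denom (a b : R) : R := b ^+ 2 + a * `|a| * circle_profile a b.
Definition orbit_x (a b : R) : R := a * `|a| * rsqrt (circle_denom a b) ^+ 2.
Definition orbit_Y (a b : R) : R := b * rsqrt (circle_denom a b).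
Definition orbit_y (a b : R) : R := velocity p (orbit_x a b) (orbit_Y a b).
Definition orbit_z (a b : R) : R :=
  acceleration p (orbit_x a b) (orbit_Y a b) (circle_profile a b).
Definition orbit_Z (a b : R) : R :=
  regular_acceleration p (orbit_x a b) (orbit_y a b) (orbit_z a b).

Lemma circle_profileN a b : circle_profile (- a) (- b) = - circle_profile a b.
Proof. by rewrite /circle_profile /profile_odd !opprK; ring. Qed.

Lemma circle_denomN a b : circle_denom (- a) (- b) = circle_denom a b.
Proof. by rewrite /circle_denom circle_profileN normrN; ring. Qed.

Lemma orbit_xN a b : orbit_x (- a) (- b) = - orbit_x a b.
Proof. by rewrite /orbit_x circle_denomN normrN; ring. Qed.

Lemma orbit_YN a b : orbit_Y (- a) (- b) = - orbit_Y a b.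
Proof. by rewrite /orbit_Y circle_denomN mulNr. Qed.

Lemma velocityN (x Y : R) : velocity p (- x) (- Y) = - velocity p x Y.
Proof. by rewrite /velocity normrN; ring. Qed.

Lemma accelerationN (x Y g : R) : acceleration p (- x) (- Y) (- g) = - acceleration p x Y g.
Proof. by rewrite /acceleration velocityN normrN; ring. Qed.

Lemma regular_accelerationN (x y z : R) :
  regular_acceleration p (- x) (- y) (- z) = - regular_acceleration p x y z.
Proof. by rewrite /regular_acceleration normrN; ring. Qed.

Lemma orbit_yN a b : orbit_y (- a) (- b) = - orbit_y a b.
Proof. by rewrite /orbit_y orbit_xN orbit_YN velocityN. Qed.

Lemma orbit_zN a b : orbit_z (- a) (- b) = - orbit_z a b.
Proof. by rewrite /orbit_z orbit_xN orbit_YN circle_profileN accelerationN. Qed.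

Lemma orbit_ZN a b : orbit_Z (- a) (- b) = - orbit_Z a b.
Proof. by rewrite /orbit_Z orbit_xN orbit_yN orbit_zN regular_accelerationN. Qed.

Hypothesis pG : profile p G.
Hypothesis oG : G 1 = - G (-1).

Lemma profile_jump0 : profile_jump 0 = 0.
Proof. by rewrite /profile_jump /profile_even expr0n subr0 sqrtr1 oG; ring. Qed.

Lemma circle_profileE (a b : R) : a ^+ 2 + b ^+ 2 = 1 -> 0 <= a -> circle_profile a b = G (- b).
Proof.
move=> ab a0; rewrite /circle_profile max_l // (_ : Num.max (- a) 0 = 0); last first.
  by rewrite max_r // oppr_le0.
rewrite profile_jump0 subr0 /profile_jump (_ : 1 - a ^+ 2 = b ^+ 2) ?sqrtr_sqr; last by rewrite -ab; ring.
rewrite /profile_odd /profile_even; case: (ger0P b) => _; first by field.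
by rewrite opprK; field.
Qed.

Lemma circle_denomE (a b : R) : a ^+ 2 + b ^+ 2 = 1 -> 0 <= a ->
  circle_denom a b = denom (- b) (G (- b)).
Proof.
move=> ab a0; have b1 : -1 <= - b <= 1 by apply/andP; split; nra.
rewrite denomE // /circle_denom circle_profileE // ger0_norm // sqrrN -ab; ring.
Qed.

Lemma circle_denom_gt0 (a b : R) : a ^+ 2 + b ^+ 2 = 1 -> 0 < circle_denom a b.
Proof.
have [_ pos _] := pG.
wlog a0 : a b / 0 <= a => [H|] ab.
  have [a0|/ltW a0] := leP 0 a; first exact: H.
  by rewrite -circle_denomN; apply: H; rewrite ?sqrrN // oppr_ge0.
by rewrite circle_denomE //; apply: pos; apply/andP; split; nra.
Qed.

Lemma orbit_energy (a b : R) : a ^+ 2 + b ^+ 2 = 1 ->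
  orbit_x a b * circle_profile a b + orbit_Y a b ^+ 2 = 1.
Proof.
move=> ab; rewrite -(rsqrt2M (circle_denom_gt0 ab)) /orbit_x /orbit_Y {4}/circle_denom.
by ring.
Qed.

Local Notation speed s := (2 * `|sin s| * rsqrt (circle_denom (sin s) (cos s)) ^+ 3).

(** For [0 < sin s] this is the arc with [t = - cos s], whose derivative [sin s] enters the speed.
    The other half follows from the shift by [pi], under which all coordinates change sign. *)
Lemma orbit_der (s : R) : sin s != 0 ->
  [/\ is_derive s 1 (fun s => orbit_x (sin s) (cos s)) (speed s * orbit_y (sin s) (cos s)),
  is_derive s 1 (fun s => orbit_y (sin s) (cos s)) (speed s * orbit_z (sin s) (cos s)) &
  is_derive s 1 (fun s => orbit_Z (sin s) (cos s))
   (speed s * (`|orbit_x (sin s) (cos s)| ^+ p.+1 * orbit_z (sin s) (cos s) / p.+1%:R))].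
Proof.
have sc (u : R) : sin u ^+ 2 + cos u ^+ 2 = 1 by rewrite addrC cos2Dsin2.
wlog s0 : s / 0 < sin s => [H|] sn0.
  have [s0|s0|s0] := ltgtP (sin s) 0; last by move: sn0; rewrite s0 eqxx.
    have sS u : sin (u - pi) = - sin u by rewrite -[in RHS](subrK pi u) sinDpi opprK.
    have cS u : cos (u - pi) = - cos u by rewrite -[in RHS](subrK pi u) cosDpi opprK.
    have s0' : 0 < sin (s - pi) by rewrite sS oppr_gt0.
    have [h1 h2 h3] := H (s - pi) s0' (lt0r_neq0 s0').
    have tr (f : R -> R -> R) (l : R) : (forall a b, f (- a) (- b) = - f a b) ->
        is_derive (s - pi) 1 (fun s => f (sin s) (cos s)) (- l) ->
        is_derive s 1 (fun s => f (sin s) (cos s)) l.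
      move=> fN df.
      have dsh : is_derive s 1 (fun u : R => u - pi) 1.
        by apply: is_derive_der (derD (is_derive_id s 1) (derC (- pi) s)) _; rewrite addr0.
      have := derN (@der_comp R (fun s => f (sin s) (cos s)) (fun u => u - pi) s _ _ df dsh).
      rewrite mulr1 opprK; apply: (@der_near _ _ _ _ _ 1) => // u _.
      by rewrite sS cS fN opprK.
    move: h1 h2 h3; rewrite !sS !cS !normrN !circle_denomN orbit_yN orbit_zN orbit_xN normrN.
    move=> h1 h2 h3; split.
    - by apply: tr; [exact: orbit_xN|rewrite -mulrN].
    - by apply: tr; [exact: orbit_yN|rewrite -mulrN].
    - by apply: tr; [exact: orbit_ZN|apply: is_derive_der h3 _; ring].
  exact: H.
have c1 : -1 < - cos s < 1 by have E := sc s; apply/andP; split; nra.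
have [d1 d2 d3] := half_orbit_der pG c1.
have dc : is_derive s 1 (fun s : R => - cos s) (sin s).
  by apply: is_derive_der (derN (is_derive_cos s)) _; rewrite opprK.
have /cvgrPdist_lt/(_ _ s0)[d /= d0 Hd] := @continuous_sin R s.
have sin_pos u : `|u - s| < d -> 0 < sin u.
  by rewrite distrC => /Hd/ltr_normlP[_ ?]; lra.
have xE u : 0 < sin u -> orbit_x (sin u) (cos u) =
    (1 - (- cos u) ^+ 2) * rsqrt (denom (- cos u) (G (- cos u))) ^+ 2.
  move=> su; rewrite /orbit_x circle_denomE ?(ltW su) // gtr0_norm // sqrrN.
  by rewrite -(sc u); ring.
have YE u : 0 < sin u -> orbit_Y (sin u) (cos u) =
    - (- cos u) * rsqrt (denom (- cos u) (G (- cos u))).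
  by move=> su; rewrite /orbit_Y circle_denomE ?(ltW su) // opprK.
have gE u : 0 < sin u -> circle_profile (sin u) (cos u) = G (- cos u).
  by move=> su; rewrite circle_profileE // ltW.
have speedE : speed s = 2 * rsqrt (denom (- cos s) (G (- cos s))) ^+ 3 * sin s.
  by rewrite gtr0_norm // circle_denomE ?(ltW s0) //; ring.
rewrite speedE; split.
- apply: (der_near d0 _ (is_derive_der (@der_comp R _ (fun s => - cos s) s _ _ d1 dc) _)) => [u /sin_pos su|].
    by rewrite /= xE.
  by rewrite /orbit_y xE // YE //; ring.
- apply: (der_near d0 _ (is_derive_der (@der_comp R _ (fun s => - cos s) s _ _ d2 dc) _)) => [u /sin_pos su|].
    by rewrite /= /orbit_y xE // YE.
  by rewrite /orbit_z xE // YE // gE //; ring.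
- apply: (der_near d0 _ (is_derive_der (@der_comp R _ (fun s => - cos s) s _ _ d3 dc) _)) => [u /sin_pos su|].
    by rewrite /= /orbit_Z /orbit_y /orbit_z xE // YE // gE.
  by rewrite /orbit_z xE // YE // gE //; ring.
Qed.

End circle_orbit.

(** * Continuity and time parametrization *)

Section continuity.
Context {R : realType} {T : topologicalType}.
Implicit Types (f g : T -> R) (x : T).

Lemma cont_comp (h : R -> R) f x : {for x, continuous f} ->
  {for f x, continuous h} -> {for x, continuous (fun u => h (f u))}.
Proof. by move=> cf ch; exact: (@continuous_comp _ _ _ f h). Qed.

Lemma contM f g x : {for x, continuous f} -> {for x, continuous g} ->
  {for x, continuous (fun u => f u * g u)}.
Proof. by move=> cf cg; exact: cvgM. Qed.

Lemma contZ (c : R) f x : {for x, continuous f} -> {for x, continuous (fun u => c * f u)}.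
Proof. by move=> cf; apply: contM => //; exact: cvg_cst. Qed.

Lemma contD f g x : {for x, continuous f} -> {for x, continuous g} ->
  {for x, continuous (fun u => f u + g u)}.
Proof. by move=> cf cg; exact: cvgD. Qed.

Lemma contN f x : {for x, continuous f} -> {for x, continuous (fun u => - f u)}.
Proof. by move=> cf; exact: cvgN. Qed.

Lemma contX n f x : {for x, continuous f} -> {for x, continuous (fun u => f u ^+ n)}.
Proof. by move=> cf; apply: (@cont_comp (fun y => y ^+ n)) => //; exact: exprn_continuous. Qed.

Lemma cont_norm f x : {for x, continuous f} -> {for x, continuous (fun u => `|f u|)}.
Proof. by move=> cf; exact: cvg_norm. Qed.

Lemma cont_sqrt f x : {for x, continuous f} -> {for x, continuous (fun u => Num.sqrt (f u))}.
Proof. by move=> cf; apply: (@cont_comp Num.sqrt) => //; exact: sqrt_continuous. Qed.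

Lemma cont_max0 f x : {for x, continuous f} -> {for x, continuous (fun u => Num.max (f u) 0)}.
Proof.
by move=> cf; apply: (@continuous_max R T f (fun=> 0)) => //; exact: cvg_cst.
Qed.

Lemma cont_velocity p f g x : {for x, continuous f} -> {for x, continuous g} ->
  {for x, continuous (fun u => velocity p (f u) (g u))}.
Proof.
move=> cf cg; apply: contD => //; apply/contN/contZ/contM => //.
exact/contX/cont_norm.
Qed.

Lemma cont_acceleration p f g (h : T -> R) x :
  {for x, continuous f} -> {for x, continuous g} -> {for x, continuous h} ->
  {for x, continuous (fun u => acceleration p (f u) (g u) (h u))}.
Proof.
move=> cf cg ch; apply: contD; first apply: contD.
- by apply/contN/contM => //; exact: cvg_cst.
- by apply/contN/contZ/contM; [exact/contX/cont_norm|exact: cont_velocity].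
- by apply/contN/contZ/contM => //; exact/contX/contX/cont_norm.
Qed.

Lemma cont_regular p f g (h : T -> R) x :
  {for x, continuous f} -> {for x, continuous g} -> {for x, continuous h} ->
  {for x, continuous (fun u => regular_acceleration p (f u) (g u) (h u))}.
Proof.
move=> cf cg ch; apply: contD => //; apply/contZ/contM => //.
exact/contX/cont_norm.
Qed.

Variables (p : nat) (G : R -> R).
Hypothesis pG : profile p G.
Hypothesis oG : G 1 = - G (-1).

Lemma cont_circle_profile f g x : {for x, continuous f} -> {for x, continuous g} ->
  {for x, continuous (fun u => circle_profile G (f u) (g u))}.
Proof.
have [cG _ _] := pG; move=> cf cg.
have cGg : {for x, continuous (fun u => G (g u))} by apply: cont_comp => //; exact: cG.
have cGNg : {for x, continuous (fun u => G (- g u))}.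
  by apply: (@cont_comp G (fun u => - g u)); [exact: contN|exact: cG].
have cJ (h : T -> R) : {for x, continuous h} -> {for x, continuous (fun u => profile_jump G (h u))}.
  move=> ch; have cs : {for x, continuous (fun u => Num.sqrt (1 - h u ^+ 2))}.
    by apply/cont_sqrt/contD; [exact: cvg_cst|exact/contN/contX].
  apply: contM; last exact: cvg_cst.
  apply: contD; last by apply: (@cont_comp G _ _ cs); exact: cG.
  by apply: (@cont_comp G _ _ (contN cs)); exact: cG.
apply: contD; first apply: contD.
- by apply: contM; [exact/contD/contN|exact: cvg_cst].
- exact/cJ/cont_max0.
- exact/contN/cJ/cont_max0/contN.
Qed.

Lemma cont_circle_denom f g x : {for x, continuous f} -> {for x, continuous g} ->
  {for x, continuous (fun u => circle_denom G (f u) (g u))}.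
Proof.
move=> cf cg; apply: contD; first exact: contX.
by apply: contM; [exact/contM/cont_norm|exact: cont_circle_profile].
Qed.

Lemma cont_rsqrt_denom f g x : f x ^+ 2 + g x ^+ 2 = 1 ->
  {for x, continuous f} -> {for x, continuous g} ->
  {for x, continuous (fun u => rsqrt (circle_denom G (f u) (g u)))}.
Proof.
move=> fg cf cg; apply: (@cont_comp rsqrt); first exact: cont_circle_denom.
exact/continuous_rsqrt/(circle_denom_gt0 pG oG).
Qed.

Lemma cont_orbit_x f g x : f x ^+ 2 + g x ^+ 2 = 1 ->
  {for x, continuous f} -> {for x, continuous g} ->
  {for x, continuous (fun u => orbit_x G (f u) (g u))}.
Proof.
move=> fg cf cg; apply: contM; first exact/contM/cont_norm.
exact/contX/cont_rsqrt_denom.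
Qed.

Lemma cont_orbit_Y f g x : f x ^+ 2 + g x ^+ 2 = 1 ->
  {for x, continuous f} -> {for x, continuous g} ->
  {for x, continuous (fun u => orbit_Y G (f u) (g u))}.
Proof. by move=> fg cf cg; apply: contM => //; exact: cont_rsqrt_denom. Qed.

Lemma cont_orbit_y f g x : f x ^+ 2 + g x ^+ 2 = 1 ->
  {for x, continuous f} -> {for x, continuous g} ->
  {for x, continuous (fun u => orbit_y p G (f u) (g u))}.
Proof. by move=> *; apply: cont_velocity; [exact: cont_orbit_x|exact: cont_orbit_Y]. Qed.

Lemma cont_orbit_z f g x : f x ^+ 2 + g x ^+ 2 = 1 ->
  {for x, continuous f} -> {for x, continuous g} ->
  {for x, continuous (fun u => orbit_z p G (f u) (g u))}.
Proof.
by move=> *; apply: cont_acceleration;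
  [exact: cont_orbit_x|exact: cont_orbit_Y|exact: cont_circle_profile].
Qed.

End continuity.

(** * From the angle to the time of the system *)

Section time_change.
Context {R : realType}.

Lemma isolated_sin_zero (s : R) : sin s = 0 ->
  exists2 d, 0 < d & forall u, 0 < `|u - s| < d -> sin u != 0.
Proof.
move=> s0; have c0 : 0 < `|cos s| by rewrite sin0cos1.
have e0 : 0 < `|cos s| / 2 by rewrite divr_gt0.
have [/(_ (is_derive_sin s))/(_ _ e0)[d d0 Hd] _] := is_deriveP sin s (cos s).
exists d => // u /andP[u0 ud]; apply/eqP => su.
have := Hd u ud; rewrite su s0 subrr sub0r normrN normrM ler_pM2r //.
by lra.
Qed.

Lemma sin_zero_countable : countable [set s : R | sin s = 0].
Proof.
have sinDn (n : nat) (u : R) : sin (u + pi *+ n) = (-1) ^+ n * sin u.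
  elim: n => [|n IH]; first by rewrite addr0 mul1r.
  by rewrite mulrSr addrA sinDpi IH exprS; ring.
have posz (s : R) : 0 <= s -> sin s = 0 -> exists n : nat, s = pi *+ n.
  move=> s0 ss; exists (Num.truncn (s / pi)); set n := Num.truncn _.
  have /andP[n1 n2] : n%:R <= s / pi < n.+1%:R.
    by apply: truncn_itv; rewrite divr_ge0 // pi_ge0.
  rewrite ler_pdivlMr ?pi_gt0 // in n1; rewrite ltr_pdivrMr ?pi_gt0 // in n2.
  pose u := s - pi *+ n.
  have u0 : 0 <= u by rewrite subr_ge0 -mulr_natl.
  have u1 : u < pi by rewrite ltrBlDr -mulrS -mulr_natl.
  have := sinDn n u; rewrite /u subrK ss => /esym/eqP.
  rewrite mulf_eq0 signr_eq0 /= -/u => /eqP su.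
  apply/eqP; rewrite -subr_eq0 -/u; apply/eqP/le_anti; rewrite u0 andbT leNgt.
  by apply/negP => u0'; have := @sin_gt0_pi R u; rewrite u0' u1 su ltxx => /(_ isT).
apply: (@sub_countable _ _ _ ((fun m : nat * bool => (-1) ^+ m.2 * (pi *+ m.1) : R) @` setT)).
  apply: subset_card_le => s /= ss; have [s0|/ltW s0] := leP 0 s.
    by have [n ->] := posz s s0 ss; exists (n, false) => //=; rewrite mul1r.
  have [||n E] := posz (- s); rewrite ?oppr_ge0 // ?sinN ?ss ?oppr0 //.
  by exists (n, true) => //=; rewrite -E expr1 mulN1r opprK.
by apply: sub_countable (card_image_le _ _) _; exact: countableP.
Qed.

(** [Th] is a primitive of the speed [w] and [sg] its inverse. [Th] is strictly increasing although
    [w] may vanish: on an interval of constancy [sin], hence also [cos], would be 0. Periodicity of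
    [w] gives [Th (s + 2 pi) = Th s + T], so [Th] is onto. *)
Lemma time_change (w : R -> R) : continuous w -> (forall s, 0 <= w s) ->
  (forall s, sin s != 0 -> w s != 0) -> (forall s, w (s + pi *+ 2) = w s) ->
  exists (Th sg : R -> R) (T : R), [/\ continuous sg, cancel Th sg, cancel sg Th,
    0 < T /\ forall t, sg (t + T) = sg t + pi *+ 2 &
    forall t : R, w (sg t) != 0 -> is_derive t 1 sg (w (sg t))^-1].
Proof.
move=> cw w0 wn0 wper; have [Th dTh] := antiderivative cw.
have cTh : continuous Th by move=> s; apply: der_continuous (dTh s).
have ndTh a b : a <= b -> Th a <= Th b.
  move=> ab; rewrite -subr_ge0.
  have := @der_le R (fun=> 0) Th (fun=> 0) w a b ab; rewrite subrr; apply.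
  - by apply: continuous_subspaceT => s; exact: cvg_cst.
  - exact: continuous_subspaceT.
  - by move=> s _; split; [exact: derC|exact: dTh|exact: w0].
have incTh a b : a < b -> Th a < Th b.
  move=> ab; rewrite lt_neqAle ndTh ?ltW // andbT; apply/eqP => E.
  have cst u : a <= u <= b -> Th u = Th a.
    by move=> /andP[au ub]; apply/eqP; rewrite eq_le {1}E !ndTh.
  have unique (f : R -> R) (x u v : R) : is_derive x 1 f u -> is_derive x 1 f v -> u = v.
    by move=> [_ <-] [_ <-].
  have sin0 u : a < u < b -> sin u = 0.
    move=> /andP[au ub]; apply/eqP; apply: contraT => /wn0/eqP; case.
    apply: unique (dTh u) _; apply: (der_near (e := Num.min (u - a) (b - u))) (derC (Th a) u).
      by rewrite lt_min !subr_gt0 au ub.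
    move=> v; rewrite lt_min => /andP[/ltr_normlP[? ?] /ltr_normlP[? ?]].
    by rewrite cst //; apply/andP; split; lra.
  have mid : a < (a + b) / 2 < b by apply/andP; split; lra.
  have : cos ((a + b) / 2) = 0.
    apply: unique (is_derive_sin _) _.
    apply: (der_near (e := (b - a) / 2)) (derC 0 _); first lra.
    by move=> v /ltr_normlP[? ?]; rewrite sin0 //; apply/andP; split; lra.
  have := cos2Dsin2 ((a + b) / 2); rewrite (sin0 _ mid) => + E0; rewrite E0 expr0n addr0 => /eqP.
  by rewrite eq_sym oner_eq0.
have injTh a b : Th a < Th b -> a < b.
  by move=> H; rewrite ltNge; apply/negP => /ndTh; rewrite leNgt H.
have [T TE] : exists T, T = Th (pi *+ 2) - Th 0 by exists (Th (pi *+ 2) - Th 0).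
have pi2 : 0 < pi *+ 2 :> R by rewrite pmulrn_lgt0 // pi_gt0.
have T0 : 0 < T by rewrite TE subr_gt0 incTh.
have ThD s : Th (s + pi *+ 2) = Th s + T.
  have d0 (s' : R) : is_derive s' 1 (fun s => Th (s + pi *+ 2) - Th s) 0.
    have dsh : is_derive s' 1 (fun u : R => u + pi *+ 2) 1.
      by apply: is_derive_der (derD (is_derive_id s' 1) (derC (pi *+ 2) s')) _; rewrite addr0.
    have := derD (@der_comp R Th (fun u => u + pi *+ 2) s' _ _ (dTh _) dsh) (derN (dTh s')).
    by rewrite mulr1 wper subrr.
  have := is_derive_0_is_cst s 0 d0; rewrite add0r -TE => E; lra.
have ThDn n s : Th (s + pi *+ 2 *+ n) = Th s + T *+ n.
  elim: n => [|n IH]; first by rewrite !mulr0n !addr0.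
  by rewrite (mulrSr (pi *+ 2)) (mulrSr T) addrA ThD IH addrA.
have surj t : exists s, Th s = t.
  pose n := Num.truncn (`|t - Th 0| / T).
  have n1 : `|t - Th 0| < T *+ n.+1.
    by rewrite -mulr_natl -ltr_pdivrMr // truncnS_gt.
  have E1 := ThDn n.+1 0; rewrite add0r in E1.
  have E2 := ThDn n.+1 (- (pi *+ 2 *+ n.+1)); rewrite addNr in E2.
  have pn : 0 <= pi *+ 2 *+ n.+1 :> R by rewrite mulrn_wge0 // ltW.
  have ab : - (pi *+ 2 *+ n.+1) <= pi *+ 2 *+ n.+1 :> R by lra.
  have [||c _ Ec] := @IVT R Th _ _ t ab; [exact: continuous_subspaceT| |by exists c].
  rewrite E1 ge_min le_max; move/ltr_normlP: n1 => [n1 n2].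
  by apply/andP; split; apply/orP; [left|right]; lra.
have [sg sgP] := choice surj.
have sgK : cancel sg Th := sgP.
have ThK : cancel Th sg.
  move=> s; apply/le_anti; rewrite !leNgt; apply/andP; split; apply/negP => /incTh;
  by rewrite sgP ltxx.
have csg : continuous sg.
  move=> t; apply/cvgrPdist_lt => /= eps eps0.
  have l1 : Th (sg t - eps) < t by rewrite -[X in _ < X]sgP incTh //; lra.
  have l2 : t < Th (sg t + eps) by rewrite -[X in X < _]sgP incTh //; lra.
  exists (Num.min (t - Th (sg t - eps)) (Th (sg t + eps) - t)).
    by rewrite /= lt_min !subr_gt0 l1.
  move=> u; rewrite /= lt_min => /andP[/ltr_normlP[? ?] /ltr_normlP[? ?]].
  have : sg t - eps < sg u by apply: injTh; rewrite sgP; lra.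
  have : sg u < sg t + eps by apply: injTh; rewrite sgP; lra.
  by move=> ? ?; rewrite ltr_norml; apply/andP; split; lra.
exists Th, sg, T; split => //.
  by split => // t; rewrite -[in LHS](sgP t) -ThD ThK.
move=> t wt; rewrite -{1}(sgP t); apply: (@is_derive_inverse R Th sg) => //.
- by exists 1 => //= s _; exact: ThK.
- by exists 1 => //= s _; exact: cTh.
Qed.

End time_change.

Section periodic_solution.
Context {R : realType}.
Variables (p : nat) (G : R -> R).
Hypothesis pG : profile p G.
Hypothesis oG : G 1 = - G (-1).

Lemma periodic_regular_solution : exists (sg : R -> R) (T : R),
  [/\ 0 < T, forall t, sg (t + T) = sg t + pi *+ 2,
    forall s, exists t, sg t = s,
    countable [set t | sin (sg t) = 0] &
    regular_solution p setT (fun t => orbit_x G (sin (sg t)) (cos (sg t)))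
      (fun t => orbit_y p G (sin (sg t)) (cos (sg t)))
      (fun t => orbit_z p G (sin (sg t)) (cos (sg t)))].
Proof.
pose w (s : R) := 2 * `|sin s| * rsqrt (circle_denom G (sin s) (cos s)) ^+ 3.
have sc (u : R) : sin u ^+ 2 + cos u ^+ 2 = 1 by rewrite addrC cos2Dsin2.
have r0 s : 0 < rsqrt (circle_denom G (sin s) (cos s)).
  by apply: rsqrt_gt0; exact: circle_denom_gt0 pG oG _ _ (sc s).
have cw : continuous w.
  move=> s; apply: (@contM R R (fun s => 2 * `|sin s|) (fun s => rsqrt (circle_denom G (sin s) (cos s)) ^+ 3)).
    exact/contZ/cont_norm/continuous_sin.
  by apply/contX/(cont_rsqrt_denom pG oG (sc s)); [exact: continuous_sin|exact: continuous_cos].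
have wn0 s : sin s != 0 -> w s != 0.
  move=> s0; apply: mulf_neq0; first by rewrite mulf_neq0 // normr_eq0.
  by rewrite expf_neq0 // gt_eqF.
have [|||Th [sg [T [csg ThK sgK [T0 sgT] dsg]]]] := time_change cw.
- by move=> s; apply: mulr_ge0; [exact: mulr_ge0|exact/exprn_ge0/ltW/r0].
- exact: wn0.
- by move=> s; rewrite /w sinD2pi cosD2pi.
exists sg, T; split; [exact: T0|exact: sgT| | |].
- by move=> s; exists (Th s); rewrite ThK.
- apply: (@sub_countable _ _ _ (Th @` [set s | sin s = 0])).
    by apply: subset_card_le => t /= st; exists (sg t).
  by apply: sub_countable (card_image_le _ _) _; exact: sin_zero_countable.
have cs t : {for t, continuous (fun t => sin (sg t))}.
  exact: (@cont_comp R R sin sg t (csg t) (@continuous_sin R _)).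
have cc t : {for t, continuous (fun t => cos (sg t))}.
  exact: (@cont_comp R R cos sg t (csg t) (@continuous_cos R _)).
have tr (f f' : R -> R -> R) (t : R) :
    (forall t, {for t, continuous (fun t => f (sin (sg t)) (cos (sg t)))}) ->
    (forall t, {for t, continuous (fun t => f' (sin (sg t)) (cos (sg t)))}) ->
    (forall s, sin s != 0 -> is_derive s 1 (fun s => f (sin s) (cos s)) (w s * f' (sin s) (cos s))) ->
    is_derive t 1 (fun t => f (sin (sg t)) (cos (sg t))) (f' (sin (sg t)) (cos (sg t))).
  move=> cf cf' df.
  have reg (u : R) : sin (sg u) != 0 ->
      is_derive u 1 (fun t => f (sin (sg t)) (cos (sg t))) (f' (sin (sg u)) (cos (sg u))).
    move=> su; have wu := wn0 _ su.
    have := @der_comp R (fun s => f (sin s) (cos s)) sg u _ _ (df _ su) (dsg _ wu).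
    by rewrite mulrAC mulfV // mul1r.
  (* At a zero of the sine the speed vanishes and the chain rule fails; it holds on a punctured
     neighbourhood, and the derivative extends by continuity. *)
  have [s0|s0] := eqVneq (sin (sg t)) 0; last exact: reg.
  have [d d0 Hd] := isolated_sin_zero s0.
  have /cvgrPdist_lt/(_ _ d0)[e /= e0 He] := csg t.
  apply: (@der_punctured _ _ (fun t => f' (sin (sg t)) (cos (sg t))) t e e0) => // u /andP[u0 ue].
  apply: reg; apply: Hd; apply/andP; split; last by rewrite distrC; apply: He; rewrite /= distrC.
  rewrite normr_gt0 subr_eq0; apply/eqP => E; move: u0.
  by rewrite -[u]sgK E sgK subrr normr0 ltxx.
have cx t : {for t, continuous (fun t => orbit_x G (sin (sg t)) (cos (sg t)))} by exact: (cont_orbit_x pG oG (sc _) (cs t) (cc t)).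
have cy t : {for t, continuous (fun t => orbit_y p G (sin (sg t)) (cos (sg t)))} by exact: (cont_orbit_y pG oG (sc _) (cs t) (cc t)).
have cz t : {for t, continuous (fun t => orbit_z p G (sin (sg t)) (cos (sg t)))} by exact: (cont_orbit_z pG oG (sc _) (cs t) (cc t)).
move=> t _; split.
- by apply: (tr _ (orbit_y p G)) => // s s0; have [] := orbit_der pG oG s0.
- by apply: (tr _ (orbit_z p G)) => // s s0; have [] := orbit_der pG oG s0.
- apply: (tr (orbit_Z p G) (fun a b => `|orbit_x G a b| ^+ p.+1 * orbit_z p G a b / p.+1%:R)).
  + by move=> u; exact: cont_regular.
  + move=> u; apply: contM; last exact: cvg_cst.
    by apply: contM => //; exact/contX/cont_norm.
  + by move=> s s0; have [] := orbit_der pG oG s0.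
Qed.

End periodic_solution.

(** * Quasi-homogeneous dilations *)

Section scaling.
Context {R : realType}.
Variable p : nat.

Definition dilate (l : R) (v : R * R * R) : R * R * R :=
  (l * v.1.1, l ^+ p.+2 * v.1.2, l ^+ (2 * p.+1).+1 * v.2).

(** The phase [c] lets the dilated solution pass through a prescribed point at a prescribed time. *)
Lemma regular_solution_dilate (l c : R) (x y z : R -> R) : 0 < l ->
  regular_solution p setT x y z ->
  regular_solution p setT (fun t => l * x (l ^+ p.+1 * t + c))
    (fun t => l ^+ p.+2 * y (l ^+ p.+1 * t + c))
    (fun t => l ^+ (2 * p.+1).+1 * z (l ^+ p.+1 * t + c)).
Proof.
move=> l0 sol t _; have [dx dy dZ] := sol (l ^+ p.+1 * t + c) I.
have da : is_derive t 1 (fun t => l ^+ p.+1 * t + c) (l ^+ p.+1).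
  by apply: is_derive_der (derD (derZ _ (is_derive_id t 1)) (derC c t)) _; rewrite addr0 mulr1.
have E : (2 * p.+1).+1 = (p.+2 + p.+1)%N by rewrite mul2n -addnn.
split.
- apply: is_derive_der (derZ l (@der_comp R x (fun t => l ^+ p.+1 * t + c) t _ _ dx da)) _.
  by rewrite [l ^+ p.+2]exprS; ring.
- apply: is_derive_der (derZ _ (@der_comp R y (fun t => l ^+ p.+1 * t + c) t _ _ dy da)) _.
  by rewrite E exprD; ring.
have := derZ (l ^+ (2 * p.+1).+1) (@der_comp R _ (fun t => l ^+ p.+1 * t + c) t _ _ dZ da).
move=> /is_derive_der d.
apply: (der_near (e := 1)) (d _ _) => // [u _|].
  by rewrite /regular_acceleration normrM gtr0_norm // exprMn E exprD [l ^+ p.+2]exprS; ring.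
by rewrite normrM gtr0_norm // exprMn; ring.
Qed.

End scaling.

(** * Filippov solutions and the regularized system *)

Section filippov.
Context {R : realType}.
Local Notation mu := (@lebesgue_measure R).

Lemma norm_prod_lt (V W : normedModType R) (u : V * W) (d : R) :
  (`|u| < d) = (`|u.1| < d) && (`|u.2| < d).
Proof. by rewrite prod_normE gt_max. Qed.

Lemma norm_prod_le (V W : normedModType R) (u : V * W) (d : R) :
  (`|u| <= d) = (`|u.1| <= d) && (`|u.2| <= d).
Proof. by rewrite prod_normE ge_max. Qed.

Lemma ball_triple (u v : R * R * R) (d : R) : ball u d v <->
  [/\ `|v.1.1 - u.1.1| < d, `|v.1.2 - u.1.2| < d & `|v.2 - u.2| < d].
Proof.
rewrite -ball_normE /ball_ /= !norm_prod_lt /= distrC (distrC u.1.2) (distrC u.2).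
by split => [/andP[/andP[]]|[-> -> ->]].
Qed.

(** The preimage of a closed ball under a continuous affine map is closed and convex. *)
Lemma closed_convex_hull_sub_ball (V W : normedModType R) (L : V -> W) (A : set V) (c : W) (d : R) :
  continuous L -> (forall l x y, L (l *: x + (1 - l) *: y) = l *: L x + (1 - l) *: L y) ->
  (forall x, A x -> `|L x - c| <= d) ->
  forall x, closed_convex_hull A x -> `|L x - c| <= d.
Proof.
move=> cL aL AL x; apply: (smallest_sub (X := [set x | `|L x - c| <= d])) => //; split.
  move=> u v l; rewrite !inE /= => hu hv.
  have -> : (conv l u v : V) = l%:num *: (u : V) + (1 - l%:num) *: (v : V) by [].
  rewrite aL.
  have -> : l%:num *: L u + (1 - l%:num) *: L v - c = l%:num *: (L u - c) + (1 - l%:num) *: (L v - c).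
    rewrite !scalerBr addrACA -opprD -scalerDl; congr (_ - _).
    by rewrite addrC subrK scale1r.
  have l0 : 0 <= l%:num :> R by [].
  have l1 : 0 <= 1 - l%:num :> R by rewrite subr_ge0.
  apply: le_trans (ler_normD _ _) _; rewrite !normrZ !ger0_norm //.
  rewrite [leRHS](_ : d = l%:num * d + (1 - l%:num) * d); last by ring.
  by apply: lerD; apply: ler_wpM2l.
apply: (@preimage_closed _ _ (fun x => `|L x - c|) [set y | y <= d]); last exact: closed_le.
by move=> u _; apply: cvg_norm; apply: cvgB; [exact: cL|exact: cvg_cst].
Qed.

(** Balls of the product norm are cubes, here of measure [(2 d)^3 > 0]. *)
Lemma lebesgue3_negligible_dense (N : set (R * R * R)) (u : R * R * R) (d : R) : 0 < d ->
  (@lebesgue3 R).-negligible N -> exists v, ball u d v /\ ~ N v.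
Proof.
move=> d0 [A [mA A0 NA]]; apply: contrapT => /forallNP H.
pose I (x : R) := `]x - d, x + d[%classic.
have sub : (I u.1.1 `*` I u.1.2) `*` I u.2 `<=` A.
  move=> v [[/= h1 h2] h3]; apply: NA; apply: contrapT => Nv.
  apply: (H v); split => //; apply/ball_triple.
  by move: h1 h2 h3; rewrite /I /= !in_itv /= !ltr_distl.
have muI x : mu (I x) = (d + d)%:E.
  rewrite /I lebesgue_measure_itv /= lte_fin ifT; last lra.
  by rewrite -EFinB; congr EFin; ring.
have mI x : measurable (I x) by exact: measurable_itv.
have : (lebesgue3 ((I u.1.1 `*` I u.1.2) `*` I u.2) <= lebesgue3 A)%E.
  apply: (@le_measure _ _ _ ((mu \x mu) \x mu)%E) => //; rewrite inE //.
  by apply: measurableX; [apply: measurableX; exact: mI|exact: mI].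
rewrite [leRHS]A0 /lebesgue3 product_measure1E; [|by apply: measurableX; exact: mI|exact: mI].
rewrite /= product_measure1E; [|exact: mI|exact: mI]; rewrite -[X in (X <= _)%E]/(mu (I u.1.1) * mu (I u.1.2) * mu (I u.2))%E !muI -!EFinM lee_fin leNgt !mulr_gt0 //; lra.
Qed.

Lemma cvg_triple (T : topologicalType) (f g h : T -> R) (x : T) :
  {for x, continuous f} -> {for x, continuous g} -> {for x, continuous h} ->
  {for x, continuous (fun u => (f u, g u, h u))}.
Proof. by move=> cf cg ch; apply: cvg_pair (cvg_pair cf cg) ch. Qed.

Lemma continuous_triple1 : continuous (fun v : R * R * R => v.1.1).
Proof. by move=> v; apply: continuous_comp; exact: cvg_fst. Qed.
Lemma continuous_triple2 : continuous (fun v : R * R * R => v.1.2).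
Proof. by move=> v; apply: continuous_comp; [exact: cvg_fst|exact: cvg_snd]. Qed.
Lemma continuous_triple3 : continuous (fun v : R * R * R => v.2).
Proof. by move=> v; exact: cvg_snd. Qed.

Lemma continuous_chazy_field (q : nat) (k : R) (v : R * R * R) : v.1.1 != 0 ->
  {for v, continuous (chazy_field q k)}.
Proof.
move=> v0; have -> : chazy_field q k = fun v => (v.1.2, v.2,
    - `|v.1.1| ^+ q * v.2 - k * `|v.1.1| ^+ q / v.1.1 * v.1.2 ^+ 2).
  by apply/funext => -[[]].
have c1 := @continuous_triple1 v; have c2 := @continuous_triple2 v; have c3 := @continuous_triple3 v.
apply: cvg_triple => //; apply: contD; first by apply: contM => //; exact/contN/contX/cont_norm.
apply/contN/contM; last exact: contX.
by apply: contM; [exact/contZ/contX/cont_norm|exact: cvgV].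
Qed.

(** The value [f v] is a limit of values at points outside the null set, as these are dense. *)
Lemma filippov_set_field (f : R * R * R -> R * R * R) (v : R * R * R) :
  {for v, continuous f} -> filippov_set f v (f v).
Proof.
move=> /cvgrPdist_lt cf d /= d0 N /= negN B /= [[_ clB] fB].
apply: clB => U /nbhs_ballP[e /= e0 eU].
have /nbhs_ballP[d' /= d'0 Hd'] := cf e e0.
have [|w [bw Nw]] := @lebesgue3_negligible_dense N v (Num.min d d') _ negN.
  by rewrite lt_min d0.
exists (f w); split; last by apply: eU; rewrite -ball_normE; apply: Hd'; apply: le_ball bw; rewrite ge_min lexx orbT.
by apply: fB; exists w => //; split => //; apply: le_ball bw; rewrite ge_min lexx.
Qed.

(** Where an affine part [L] of the field is continuous, Filippov's regularization does not enlarge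
    it. It is used with [fst], the first two components being continuous everywhere, and with [id]
    away from [x = 0]. *)
Lemma filippov_set_continuous (V : normedModType R) (L : R * R * R -> V) (f : R * R * R -> R * R * R)
    (v w : R * R * R) : continuous L ->
  (forall l x y, L (l *: x + (1 - l) *: y) = l *: L x + (1 - l) *: L y) ->
  {for v, continuous (fun u => L (f u))} -> filippov_set f v w -> L w = L (f v).
Proof.
move=> cL aL /cvgrPdist_le cf Fw; apply/eqP; rewrite -subr_eq0 -normr_eq0 eq_le normr_ge0 andbT.
apply/ler_addgt0Pl => e e0; rewrite addr0.
have /nbhs_ballP[d /= d0 Hd] := cf e e0.
have neg0 : (@lebesgue3 R).-negligible set0 by exact: (@negligible_set0 _ _ _ ((mu \x mu) \x mu)%E).
apply: (closed_convex_hull_sub_ball cL aL) (Fw d d0 set0 neg0) => _ [u [bu _] <-].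
by rewrite distrC; exact: Hd.
Qed.

Lemma filippov_set_fst (q : nat) (k : R) (v w : R * R * R) :
  filippov_set (chazy_field q k) v w -> w.1 = (v.1.2, v.2).
Proof.
move=> Fw; have -> : w.1 = (chazy_field q k v).1; last by case: v {Fw} => [[]].
apply: (@filippov_set_continuous _ fst (chazy_field q k) v w _ _ _ Fw).
- by move=> u; exact: cvg_fst.
- by [].
- have -> : (fun u => (chazy_field q k u).1) = fun u => (u.1.2, u.2) by apply/funext => -[[]].
  by apply: cvg_pair (@continuous_triple2 v) (@continuous_triple3 v).
Qed.

Lemma filippov_set_neq0 (q : nat) (k : R) (v w : R * R * R) : v.1.1 != 0 ->
  filippov_set (chazy_field q k) v w -> w = chazy_field q k v.
Proof.
move=> v0 Fw; apply: (@filippov_set_continuous _ id (chazy_field q k) v w) => //.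
- by move=> u; exact: cvg_id.
- exact: continuous_chazy_field.
Qed.

End filippov.

Section derivative_pairs.
Context {R : realType}.

Lemma is_derive_cvgP (V : normedModType R) (g : R -> V) (t : R) (v : V) :
  is_derive t (1 : R) g v <->
  (fun h : R => h^-1 *: (g (h *: (1 : R) + t) - g t)) @ 0^' --> v.
Proof.
split=> [[dg <-]|C]; first exact: dg.
by split; [apply/cvg_ex; exists v|exact: cvg_lim C].
Qed.

Lemma der_fst (V W : normedModType R) (g : R -> V * W) (t : R) (v : V * W) :
  is_derive t (1 : R) g v -> is_derive t (1 : R) (fun u => (g u).1) v.1.
Proof.
move=> /is_derive_cvgP C; apply/is_derive_cvgP.
exact: (cvg_comp _ _ C (@cvg_fst _ _ (nbhs v.1) (nbhs v.2) _)).
Qed.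

Lemma der_snd (V W : normedModType R) (g : R -> V * W) (t : R) (v : V * W) :
  is_derive t (1 : R) g v -> is_derive t (1 : R) (fun u => (g u).2) v.2.
Proof.
move=> /is_derive_cvgP C; apply/is_derive_cvgP.
exact: (cvg_comp _ _ C (@cvg_snd _ _ (nbhs v.1) (nbhs v.2) _)).
Qed.

Lemma der_pair (V W : normedModType R) (f : R -> V) (g : R -> W) (t : R) (v : V) (w : W) :
  is_derive t (1 : R) f v -> is_derive t (1 : R) g w ->
  is_derive t (1 : R) (fun u => (f u, g u)) (v, w).
Proof.
move=> /is_derive_cvgP C1 /is_derive_cvgP C2; apply/is_derive_cvgP.
exact: (cvg_pair C1 C2).
Qed.

End derivative_pairs.

(** * Absolutely continuous functions with a continuous almost everywhere derivative *)

Section absolutely_continuous_derivative.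
Context {R : realType}.
Local Notation mu := (@lebesgue_measure R).

Lemma ac_comp (V W : normedModType R) (L : V -> W) (g : R -> V) (a b : R) :
  (forall u v, `|L u - L v| <= `|u - v|) -> absolutely_continuous_on a b g ->
  absolutely_continuous_on a b (fun t => L (g t)).
Proof.
move=> HL H e e0; have [d d0 Hd] := H e e0; exists d => // n u v A B C.
by apply: le_lt_trans (Hd n u v A B C); apply: ler_sum.
Qed.

Lemma ac_continuous (V : normedModType R) (g : R -> V) (a b t : R) : a < t < b ->
  absolutely_continuous_on a b g -> {for t, continuous g}.
Proof.
move=> /andP[at_ tb] H; apply/cvgrPdist_lt => e e0; have [d d0 Hd] := H e e0.
exists (Num.min d (Num.min (t - a) (b - t))); first by rewrite /= !lt_min d0 !subr_gt0 at_.
move=> s; rewrite /= !lt_min => /and3P[h1 /ltr_normlP[h2 h3] /ltr_normlP[h4 h5]].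
have K (u v : R) : a <= u -> u <= v -> v <= b -> v - u < d -> `|g v - g u| < e.
  move=> au uv vb uvd; have := Hd 1%N (fun=> u) (fun=> v); rewrite !big_ord1; apply => //.
  by move=> i j; rewrite ltnS; case: j => [|j]; rewrite ?ltn0 ?andbF.
have [st|/ltW ts] := leP s t.
  by apply: K => //; [lra|exact: ltW|move/ltr_normlP: h1 => [? ?]; lra].
by rewrite distrC; apply: K => //; [exact: ltW|lra|move/ltr_normlP: h1 => [? ?]; lra].
Qed.

(** Near [t] the function [df] stays within [e] of [df t], so the almost everywhere mean value
    inequality, for [f] and for [- f], gives the first order estimate at every point. *)
Lemma ac_ae_is_derive (f df : R -> R) (a b : R) (N : set R) :
  (forall c d : R, a < c -> d < b -> absolutely_continuous_on c d f) ->
  mu.-negligible N -> (forall t, a < t < b -> {for t, continuous df}) ->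
  (forall t : R, a < t < b -> ~ N t -> is_derive t 1 f (df t)) ->
  forall t : R, a < t < b -> is_derive t 1 f (df t).
Proof.
move=> acf negN cdf H t tab; apply/is_deriveP => e e0.
have /cvgrPdist_le/(_ _ e0)[d /= d0 Hd] := cdf t tab.
have /andP[at_ tb] := tab.
have acN (c d' : R) : a < c -> d' < b -> absolutely_continuous_on c d' (fun t => - f t).
  move=> ac db; apply: (ac_comp (L := -%R)) (acf _ _ ac db) => u v.
  by rewrite -opprD normrN.
have K (u v : R) : u <= v -> a < u -> v < b -> (forall s, u <= s <= v -> `|t - s| < d) ->
    `|f v - f u - df t * (v - u)| <= e * (v - u).
  move=> uv au vb near; have bnd (s : R) : u <= s <= v -> `|df t - df s| <= e.
    by move=> /near; exact: Hd.
  have inab (s : R) : u <= s <= v -> a < s < b.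
    by move=> /andP[us sv]; rewrite (lt_le_trans au) // (le_lt_trans sv).
  have h1 := @ac_ae_der_le R f u v (df t + e) N uv (acf _ _ au vb) negN.
  have h2 := @ac_ae_der_le R (fun t => - f t) u v (e - df t) N uv (acN _ _ au vb) negN.
  have {}h1 : f v - f u <= (df t + e) * (v - u).
    apply: h1 => s suv Ns; exists (df s); first exact: H (inab _ suv) Ns.
    by have /ler_normlP[? ?] := bnd _ suv; lra.
  have {}h2 : - f v - - f u <= (e - df t) * (v - u).
    apply: h2 => s suv Ns; exists (- df s); first by apply: derN; exact: H (inab _ suv) Ns.
    by have /ler_normlP[? ?] := bnd _ suv; lra.
  by rewrite ler_norml; apply/andP; split; lra.
exists (Num.min d (Num.min (t - a) (b - t))); first by rewrite !lt_min d0 !subr_gt0 at_.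
move=> s; rewrite !lt_min => /and3P[/ltr_normlP[h0 h1] /ltr_normlP[h2 h3] /ltr_normlP[h4 h5]].
have [ts|/ltW st] := leP t s.
  rewrite [`|s - t|]ger0_norm ?subr_ge0 //; apply: K => //; first lra.
  by move=> u /andP[tu us]; rewrite ltr_norml; apply/andP; split; lra.
rewrite [`|s - t|]ler0_norm ?subr_le0 // opprB.
have -> : f s - f t - df t * (s - t) = - (f t - f s - df t * (t - s)) by ring.
rewrite normrN; apply: K => //; first lra.
by move=> u /andP[su ut]; rewrite ltr_norml; apply/andP; split; lra.
Qed.

End absolutely_continuous_derivative.

(** * Trajectories versus solutions of the regularized system *)

Section trajectories.
Context {R : realType}.
Variable p : nat.
Local Notation Q := (p.+1%:R : R).
Local Notation k := (p.+1%:R + 1 : R).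
Local Notation chazy_z x y z := (- `|x| ^+ p.+1 * z - k * `|x| ^+ p.+1 / x * y ^+ 2).

(* For [1 < q] the value [0] of [`|0| ^+ q / 0] is the actual derivative of
   [`|x| ^+ q / q] at [0]. *)
Lemma der_norm_expr (x : R) : x != 0 \/ (0 < p)%N ->
  is_derive x 1 (fun u => `|u| ^+ p.+1) (Q * (`|x| ^+ p.+1 / x)).
Proof.
have pos (u : R) : 0 < u -> is_derive u 1 (fun u => `|u| ^+ p.+1) (Q * (`|u| ^+ p.+1 / u)).
  move=> u0; apply: is_derive_der (derX p.+1 (der_norm_gt0 u0 (is_derive_id u 1))) _.
  by rewrite gtr0_norm //= mulr1 exprSr mulfK // gt_eqF.
case: (ltgtP x 0) => [x0 _|x0 _|->]; last first.
- case=> [//|p0].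
  rewrite invr0 mulr0 mulr0; apply/is_deriveP => e e0.
  exists (Num.min e 1); first by rewrite lt_min e0 ltr01.
  move=> u; rewrite subr0 lt_min => /andP[ue u1].
  rewrite normr0 expr0n subr0 mul0r subr0 normrX normr_id exprSr.
  apply: ler_wpM2r => //; case: (p) p0 => // p' _; rewrite exprS.
  apply: le_trans (ltW ue); apply: ler_piMr => //.
  by apply: exprn_ile1 => //; exact: ltW.
- exact: pos.
have Nx0 : 0 < - x by rewrite oppr_gt0.
apply: (der_near (e := 1)) (is_derive_der (@der_comp R (fun u => `|u| ^+ p.+1) -%R x _ _ (pos _ Nx0) (derN (is_derive_id x 1))) _) => // [u _|].
  by rewrite /= normrN.
by rewrite normrN invrN; ring.
Qed.

Lemma regular_of_field (x y z : R -> R) (t : R) : x t != 0 \/ (0 < p)%N ->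
  is_derive t 1 x (y t) -> is_derive t 1 y (z t) ->
  is_derive t 1 z (chazy_z (x t) (y t) (z t)) ->
  is_derive t 1 (fun t => regular_acceleration p (x t) (y t) (z t))
        (`|x t| ^+ p.+1 * z t / p.+1%:R).
Proof.
move=> hx dx dy dz.
have dn := @der_comp R (fun u => `|u| ^+ p.+1) x t _ _ (der_norm_expr hx) dx.
apply: is_derive_der (derD dz (derZ (p.+2%:R / p.+1%:R) (derM dn dy))) _.
(* The inverse becomes an unknown: the singular terms cancel whatever its value, so the case
   [x t = 0] is included. *)
rewrite -[p.+2%:R]natr1; move: (x t)^-1 => xi.
have p0 : 0 <= p%:R :> R by [].
by field; rewrite gt_eqF //; lra.
Qed.

Lemma field_of_regular (x y z : R -> R) (t : R) : x t != 0 \/ (0 < p)%N ->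
  is_derive t 1 x (y t) -> is_derive t 1 y (z t) ->
  is_derive t 1 (fun t => regular_acceleration p (x t) (y t) (z t))
        (`|x t| ^+ p.+1 * z t / p.+1%:R) ->
  is_derive t 1 z (chazy_z (x t) (y t) (z t)).
Proof.
move=> hx dx dy dZ.
have dn := @der_comp R (fun u => `|u| ^+ p.+1) x t _ _ (der_norm_expr hx) dx.
apply: (der_near (e := 1)) (is_derive_der (derD dZ (derN (derZ (p.+2%:R / p.+1%:R) (derM dn dy)))) _) => // [u _|].
  by rewrite /regular_acceleration addrK.
rewrite -[p.+2%:R]natr1; move: (x t)^-1 => xi.
have p0 : 0 <= p%:R :> R by [].
by field; rewrite gt_eqF //; lra.
Qed.

Definition triple (x y z : R -> R) (t : R) : R * R * R := (x t, y t, z t).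

Lemma continuous_bounded_itv (f : R -> R) (c d : R) :
  (forall t, c <= t <= d -> {for t, continuous f}) ->
  exists2 M, 0 <= M & forall t, c <= t <= d -> `|f t| <= M.
Proof.
move=> cf; have [cd|dc] := leP c d; last first.
  by exists 0 => // t /andP[ct td]; have := le_trans ct td; rewrite leNgt dc.
have [|m _ Hm] := @EVT_max R (fun t => `|f t|) c d cd.
  by apply: within_itv_continuous => t tcd; exact: cont_norm (cf t tcd).
by exists `|f m| => // t tcd; apply: Hm; rewrite in_itv.
Qed.

Lemma lipschitz_ac (V : normedModType R) (g : R -> V) (c d L : R) :
  (forall u v, c <= u -> u <= v -> v <= d -> `|g v - g u| <= L * (v - u)) ->
  absolutely_continuous_on c d g.
Proof.
move=> lip e e0; have L0 : 0 < `|L| + 1 by rewrite ltr_wpDl.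
exists (e / (`|L| + 1)); first exact: divr_gt0.
move=> n u v A _; rewrite ltr_pdivlMr // => S; apply: le_lt_trans S.
rewrite mulrC mulr_sumr; apply: ler_sum => i _; have [cu uv vd] := A i (ltn_ord i).
apply: le_trans (lip _ _ cu uv vd) _; apply: ler_wpM2r; first by rewrite subr_ge0.
by have := ler_norm L; lra.
Qed.

Lemma der_lipschitz (f df : R -> R) (c d : R) :
  (forall t : R, is_derive t 1 f (df t)) -> continuous df ->
  exists2 M, 0 <= M &
    forall u v, c <= u -> u <= v -> v <= d -> `|f v - f u| <= M * (v - u).
Proof.
move=> dF cdf; have [M M0 HM] := continuous_bounded_itv (fun t (_ : c <= t <= d) => cdf t).
exists M => // u v cu uv vd; apply: (der_bound uv).
  by apply: continuous_subspaceT => t; apply: der_continuous (dF t).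
move=> t /andP[ut tv]; split; first exact: dF.
by apply: HM; rewrite (le_trans cu) ?(le_trans _ vd) // ltW.
Qed.

Lemma regular_continuous (I : set R) (x y z : R -> R) (t : R) :
  regular_solution p I x y z -> I t ->
  [/\ {for t, continuous x}, {for t, continuous y} & {for t, continuous z}].
Proof.
move=> sol It; have [dx dy dZ] := sol t It.
have cx := der_continuous dx; have cy := der_continuous dy.
split => //.
have -> : z = fun t => regular_acceleration p (x t) (y t) (z t) - Q^-1 * p.+2%:R * (`|x t| ^+ p.+1 * y t).
  by apply/funext => u; rewrite /regular_acceleration; ring.
apply: contD; first exact: der_continuous dZ.
by apply/contN/contZ/contM => //; exact/contX/cont_norm.
Qed.

(** For [q = 1] the times with [x = 0] form a null set, at which the inclusion may fail; absolute
    continuity across them holds since the curve is Lipschitz on bounded intervals. *)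
Lemma regular_trajectory (x y z : R -> R) :
  regular_solution p setT x y z -> countable [set t | x t = 0] ->
  chazy_trajectory p.+1 k setT (triple x y z).
Proof.
move=> sol cx.
have cl (t : R) : x t != 0 \/ (0 < p)%N ->
    is_derive t (1 : R) (triple x y z) (chazy_field p.+1 k (triple x y z t)).
  move=> hx; have [dx dy dZ] := sol t I.
  by apply: der_pair; [exact: der_pair|exact: field_of_regular].
rewrite /chazy_trajectory; case: ifPn => [|p1]; last first.
  by move=> t _; apply: cl; right; rewrite lt0n.
move=> p1; split; last first.
  have neg : (@lebesgue_measure R).-negligible [set t | x t = 0].
    by exists [set t | x t = 0]; split => //; [exact: countable_measurable|exact: countable_lebesgue_measure0].
  suff S : ~` [set t | setT t -> exists2 v, is_derive t (1 : R) (triple x y z) v &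
      filippov_set (chazy_field p.+1 k) (triple x y z t) v] `<=` [set t | x t = 0].
    by have [A [mA A0 sA]] := neg; exists A; split => //; exact: subset_trans S sA.
  move=> t /= H; apply: contrapT => /eqP xt; apply: H => _.
  exists (chazy_field p.+1 k (triple x y z t)); first by apply: cl; left.
  by apply: filippov_set_field; apply: continuous_chazy_field; exact: xt.
have p0 : p = 0%N by move/eqP: p1 => -[].
move=> c d _.
have cx' t : {for t, continuous x} by have [] := regular_continuous sol (I : setT t).
have cy t : {for t, continuous y} by have [] := regular_continuous sol (I : setT t).
have cz t : {for t, continuous z} by have [] := regular_continuous sol (I : setT t).
have dx (t : R) : is_derive t 1 x (y t) by have [] := sol t I.
have dy (t : R) : is_derive t 1 y (z t) by have [] := sol t I.
have dZ (t : R) : is_derive t 1 (fun t => regular_acceleration p (x t) (y t) (z t))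
        (`|x t| ^+ p.+1 * z t / p.+1%:R) by have [] := sol t I.
have [Lx Lx0 lx] := @der_lipschitz x y c d dx cy.
have [Ly Ly0 ly] := @der_lipschitz y z c d dy cz.
have [|LZ LZ0 lZ] := der_lipschitz c d dZ.
  move=> t; apply: (@contM R R (fun t => `|x t| ^+ p.+1 * z t) (fun=> Q^-1) t).
    by apply: (@contM R R (fun t => `|x t| ^+ p.+1) z t) => //; exact/contX/cont_norm.
  exact: cvg_cst.
have [Mx Mx0 mx] := continuous_bounded_itv (fun t (_ : c <= t <= d) => cx' t).
have [My My0 my] := continuous_bounded_itv (fun t (_ : c <= t <= d) => cy t).
(* For [q = 1] one has [z = Z - 2 |x| y]; this is the product rule for Lipschitz constants. *)
pose L := LZ + 2 * (Mx * Ly + Lx * My).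
apply: (@lipschitz_ac _ _ c d (Num.max (Num.max Lx Ly) L)) => u v cu uv vd.
have uv0 : 0 <= v - u by rewrite subr_ge0.
rewrite !norm_prod_le /=; apply/andP; split; first (apply/andP; split).
- by apply: le_trans (lx _ _ cu uv vd) _; apply: ler_wpM2r; rewrite // !le_max lexx.
- by apply: le_trans (ly _ _ cu uv vd) _; apply: ler_wpM2r; rewrite // !le_max lexx orbT.
apply: (@le_trans _ _ (L * (v - u))); last by apply: ler_wpM2r; rewrite // !le_max lexx orbT.
have -> : z v - z u = (regular_acceleration p (x v) (y v) (z v) - regular_acceleration p (x u) (y u) (z u))
   - 2 * (`|x v| * (y v - y u) + (`|x v| - `|x u|) * y u).
  by rewrite /regular_acceleration p0 !expr1 divr1; ring.
apply: le_trans (ler_normB _ _) _; rewrite /L [leRHS]mulrDl; apply: lerD (lZ _ _ cu uv vd) _.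
rewrite normrM ger0_norm // -[leRHS]mulrA; apply: ler_wpM2l => //.
apply: le_trans (ler_normD _ _) _; rewrite !normrM normr_id.
rewrite [leRHS](_ : _ = Mx * (Ly * (v - u)) + Lx * (v - u) * My); last by ring.
apply: lerD.
  apply: ler_pM => //; last exact: ly.
  by apply: mx; rewrite vd (le_trans cu).
apply: ler_pM => //; last by apply: my; rewrite cu (le_trans uv).
by apply: le_trans (ler_dist_dist _ _) _; exact: lx.
Qed.

(** A zero of [x] with [y <> 0] is a transversal crossing, hence isolated. *)
Lemma punctured_neq0 (x y : R -> R) (t e : R) : 0 < e ->
  (forall u : R, `|u - t| < e -> is_derive u 1 x (y u)) -> x t != 0 \/ y t != 0 ->
  exists2 d, 0 < d <= e & forall u, 0 < `|u - t| < d -> x u != 0.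
Proof.
move=> e0 dx h.
have dxt : is_derive t 1 x (y t) by apply: dx; rewrite subrr normr0.
have [xt|xt] := eqVneq (x t) 0; last first.
  have /cvgrPdist_lt/(_ `|x t|) := der_continuous dxt.
  rewrite normr_gt0 => /(_ xt)[d /= d0 Hd].
  exists (Num.min d e); first by rewrite lt_min d0 e0 ge_min lexx orbT.
  move=> u /andP[_]; rewrite lt_min => /andP[ud _]; apply/eqP => xu.
  by have := Hd u; rewrite /= distrC => /(_ ud); rewrite xu subr0 ltxx.
have yt : 0 < `|y t| by case: h; rewrite ?xt ?eqxx // normr_gt0.
have e2 : 0 < `|y t| / 2 by rewrite divr_gt0.
have [/(_ dxt)/(_ _ e2)[d d0 Hd] _] := is_deriveP x t (y t).
exists (Num.min d e); first by rewrite lt_min d0 e0 ge_min lexx orbT.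
move=> u /andP[u0]; rewrite lt_min => /andP[ud _]; apply/eqP => xu.
have := Hd u ud; rewrite xu xt subr0 sub0r normrN normrM ler_pM2r //; lra.
Qed.

Lemma trajectory_continuous (a b t : R) (g : R -> R * R * R) :
  chazy_trajectory p.+1 k `]a, b[%classic g -> a < t < b -> {for t, continuous g}.
Proof.
move=> traj tab; have /andP[at_ tb] := tab.
have [p0|p0] := posnP p; last first.
  have : classical_solution (chazy_field p.+1 k) `]a, b[%classic g.
    by move: traj; rewrite /chazy_trajectory; case: ifPn => // /eqP[E]; rewrite E in p0.
  move=> /(_ t); rewrite /= in_itv /= => /(_ tab) [dg _].
  exact/differentiable_continuous/derivable1_diffP.
have [acg _] : filippov_solution (chazy_field p.+1 k) `]a, b[%classic g.
  by move: traj; rewrite /chazy_trajectory p0.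
apply: (@ac_continuous _ _ g ((a + t) / 2) ((t + b) / 2)).
  by apply/andP; split; lra.
by apply: acg => s /=; rewrite !in_itv /= => /andP[? ?]; apply/andP; split; lra.
Qed.

(** For [q = 1] the equations of [x] and [y] hold almost everywhere with continuous right-hand
    sides, hence everywhere. That of [z] holds on each side of [t], where [x <> 0], and [Z] inherits
    its equation at [t] by continuity. *)
Lemma trajectory_regular (a b t : R) (g : R -> R * R * R) :
  chazy_trajectory p.+1 k `]a, b[%classic g -> a < t < b ->
  (g t).1.1 != 0 \/ (g t).1.2 != 0 \/ (0 < p)%N ->
  exists2 e, 0 < e & regular_solution p [set u | `|u - t| < e]
    (fun u => (g u).1.1) (fun u => (g u).1.2) (fun u => (g u).2).
Proof.
move=> traj tab h; have /andP[at_ tb] := tab.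
pose e0 := Num.min (t - a) (b - t).
have e00 : 0 < e0 by rewrite lt_min !subr_gt0 at_.
have near (u : R) : `|u - t| < e0 -> a < u < b.
  by rewrite lt_min => /andP[/ltr_normlP[? ?] /ltr_normlP[? ?]]; apply/andP; split; lra.
have [p0|p0] := posnP p; last first.
  exists e0 => // u /= /near uab.
  have : classical_solution (chazy_field p.+1 k) `]a, b[%classic g.
    by move: traj; rewrite /chazy_trajectory; case: ifPn => // /eqP[E]; rewrite E in p0.
  move=> /(_ u); rewrite /= in_itv /= => /(_ uab) dg.
  have d1 := der_fst (der_fst dg); have d2 := der_snd (der_fst dg); have d3 := der_snd dg.
  have E : chazy_field p.+1 k (g u) = ((g u).1.2, (g u).2, chazy_z (g u).1.1 (g u).1.2 (g u).2).
    by case: (g u) => [[]].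
  rewrite E /= in d1 d2 d3.
  split; [exact: d1|exact: d2|].
  by apply: regular_of_field; right.
have [acg aeg] : filippov_solution (chazy_field p.+1 k) `]a, b[%classic g.
  by move: traj; rewrite /chazy_trajectory p0.
have {}acg (c d : R) : a < c -> d < b -> absolutely_continuous_on c d g.
  by move=> ac db; apply: acg => s /=; rewrite !in_itv /= => /andP[cs sd]; rewrite (lt_le_trans ac) // (le_lt_trans sd).
pose N := ~` [set s | `]a, b[%classic s -> exists2 v, is_derive s (1 : R) g v & filippov_set (chazy_field p.+1 k) (g s) v].
have negN : (@lebesgue_measure R).-negligible N := aeg.
have NP s : a < s < b -> ~ N s ->
    exists2 v, is_derive s (1 : R) g v & filippov_set (chazy_field p.+1 k) (g s) v.
  by move=> sab /contrapT; apply; rewrite /= in_itv.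
have cg s : a < s < b -> {for s, continuous g}.
  exact: trajectory_continuous traj.
have cx s : a < s < b -> {for s, continuous (fun u => (g u).1.1)}.
  by move=> /cg cgs; exact: (@continuous_comp _ _ _ g (fun v => v.1.1) s cgs (@continuous_triple1 R _)).
have cy s : a < s < b -> {for s, continuous (fun u => (g u).1.2)}.
  by move=> /cg cgs; exact: (@continuous_comp _ _ _ g (fun v => v.1.2) s cgs (@continuous_triple2 R _)).
have cz s : a < s < b -> {for s, continuous (fun u => (g u).2)}.
  by move=> /cg cgs; exact: (@continuous_comp _ _ _ g (fun v => v.2) s cgs (@continuous_triple3 R _)).
have dx (s : R) : a < s < b -> is_derive s 1 (fun u => (g u).1.1) (g s).1.2.
  apply: (@ac_ae_is_derive _ (fun u => (g u).1.1) (fun u => (g u).1.2) a b N) => // [c d ac db|u uab Nu].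
    by apply: (@ac_comp R _ _ (fun v : R * R * R => v.1.1) g _ _ _ (acg _ _ ac db)) => u v; rewrite !prod_normE /= !le_max lexx.
  have [v dv /filippov_set_fst Fv] := NP u uab Nu.
  by have := der_fst (der_fst dv); rewrite Fv.
have dy (s : R) : a < s < b -> is_derive s 1 (fun u => (g u).1.2) (g s).2.
  apply: (@ac_ae_is_derive _ (fun u => (g u).1.2) (fun u => (g u).2) a b N) => // [c d ac db|u uab Nu].
    by apply: (@ac_comp R _ _ (fun v : R * R * R => v.1.2) g _ _ _ (acg _ _ ac db)) => u v; rewrite !prod_normE /= !le_max lexx orbT.
  have [v dv /filippov_set_fst Fv] := NP u uab Nu.
  by have := der_snd (der_fst dv); rewrite Fv.
have [|d /andP[d0 de] Hd] := punctured_neq0 e00 (fun u ue => dx u (near u ue)).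
  by case: h => [->|[->|]]; [left|right|rewrite p0].
have chazyE u : chazy_field p.+1 k (g u) = ((g u).1.2, (g u).2, chazy_z (g u).1.1 (g u).1.2 (g u).2).
  by case: (g u) => [[]].
have dz (c1 c2 : R) : a <= c1 -> c2 <= b -> (forall u, c1 < u < c2 -> (g u).1.1 != 0) ->
    forall u : R, c1 < u < c2 -> is_derive u 1 (fun u => (g u).2) (chazy_z (g u).1.1 (g u).1.2 (g u).2).
  move=> ac cb x0.
  have sub (u : R) : c1 < u < c2 -> a < u < b.
    by move=> /andP[cu uc]; rewrite (le_lt_trans ac) // (lt_le_trans uc).
  apply: (@ac_ae_is_derive _ (fun u => (g u).2) (fun u => chazy_z (g u).1.1 (g u).1.2 (g u).2) c1 c2 N) => //.
  - move=> c d' cc dc; apply: (@ac_comp R _ _ (fun v : R * R * R => v.2) g _ _ _ (acg c d' _ _)); [|exact: le_lt_trans cc|exact: lt_le_trans cb].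
    by move=> u v; rewrite !prod_normE /= !le_max lexx orbT.
  - move=> u uc; have uab := sub u uc.
    have cxu := cx u uab; have cyu := cy u uab; have czu := cz u uab.
    apply: contD; first by apply: contM => //; exact/contN/contX/cont_norm.
    apply/contN/contM; last exact: contX.
    by apply: contM; [exact/contZ/contX/cont_norm|exact: cvgV (x0 u uc) _].
  - move=> u uc Nu; have [v dv /(filippov_set_neq0 (x0 u uc)) Fv] := NP u (sub u uc) Nu.
    by have := der_snd dv; rewrite Fv chazyE.
have dab (u : R) : `|u - t| < d -> a < u < b by move=> ud; apply: near; exact: lt_le_trans de.
have [dta dtb] : a <= t - d /\ t + d <= b.
  by move: de; rewrite /e0 le_min => /andP[? ?]; split; lra.
have dZ (u : R) : 0 < `|u - t| < d ->
    is_derive u 1 (fun u => regular_acceleration p (g u).1.1 (g u).1.2 (g u).2)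
      (`|(g u).1.1| ^+ p.+1 * (g u).2 / p.+1%:R).
  move=> utd; have /andP[ut ud] := utd; have uab := dab u ud.
  apply: regular_of_field; [left; exact: Hd|exact: dx|exact: dy|].
  move/ltr_normlP: ud => [h1 h2]; rewrite normr_gt0 subr_eq0 in ut.
  have [tu|ut'|E] := ltgtP t u; last by rewrite E eqxx in ut.
  - apply: (dz t (t + d)) => //; [exact: ltW| |by rewrite tu; lra].
    move=> v /andP[tv vd]; apply: Hd; rewrite gtr0_norm ?subr_gt0 //.
    by rewrite tv; lra.
  - apply: (dz (t - d) t) => //; [exact: ltW| |by rewrite ut' andbT; lra].
    move=> v /andP[tv vd]; apply: Hd; rewrite ltr0_norm ?subr_lt0 // opprB subr_gt0.
    by rewrite vd; lra.
exists d => // u /= ud; have uab := dab u ud; split; [exact: dx|exact: dy|].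
have [ut|ut] := eqVneq u t; last by apply: dZ; rewrite normr_gt0 subr_eq0 ut.
have ctx := cx t tab; have cty := cy t tab; have ctz := cz t tab.
rewrite ut; apply: (der_punctured d0 dZ); first exact: cont_regular.
apply: contM; last exact: cvg_cst.
by apply: contM => //; exact/contX/cont_norm.
Qed.

End trajectories.

(** * Uniqueness *)

Section uniqueness.
Context {R : realType}.

Lemma sqrrD3_le (x y z : R) : (x + y + z) ^+ 2 <= 3 * (x ^+ 2 + y ^+ 2 + z ^+ 2).
Proof.
have := sqr_ge0 (x - y); have := sqr_ge0 (x - z); have := sqr_ge0 (y - z).
by rewrite !expr2; lra.
Qed.

(** [E expR (- L (t - t0))] is nonincreasing to the right of [t0], and [E expR (L (t - t0))] is
    nondecreasing to the left. *)
Lemma gronwall0 (E dE : R -> R) (t0 e L : R) : E t0 = 0 ->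
  (forall u : R, `|u - t0| < e -> [/\ 0 <= E u, is_derive u 1 E (dE u) & `|dE u| <= L * E u]) ->
  forall u, `|u - t0| < e -> E u = 0.
Proof.
move=> E0 H u ue; have [Eu0 _ _] := H u ue; apply/eqP; rewrite eq_le Eu0 andbT.
have dexp (c s : R) : is_derive s 1 (fun s => expR (c * (s - t0))) (expR (c * (s - t0)) * c).
  apply: is_derive_der (@der_comp R expR (fun s => c * (s - t0)) s _ _ (is_derive_expR _)
    (derZ c (derD (is_derive_id s 1) (derC (- t0) s)))) _.
  by rewrite addr0 mulr1.
have dF (c s : R) : `|s - t0| < e -> is_derive s 1 (fun s => E s * expR (c * (s - t0)))
    ((dE s + c * E s) * expR (c * (s - t0))).
  move=> se; have [_ dEs _] := H s se.
  by apply: is_derive_der (derM dEs (dexp c s)) _; ring.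
have cF (c s : R) : `|s - t0| < e -> {for s, continuous (fun s => E s * expR (c * (s - t0)))}.
  by move=> se; exact: der_continuous (dF c s se).
have c0 (s : R) : is_derive s 1 (fun=> 0 : R) 0 := derC 0 s.
have K (c : R) : E u * expR (c * (u - t0)) <= 0 -> E u <= 0.
  by rewrite pmulr_lle0 // expR_gt0.
move/ltr_normlP: ue => [ue1 ue2].
have [tu|/ltW ut] := leP t0 u.
  apply: (K (- L)).
  have := @der_le R (fun s => E s * expR (- L * (s - t0))) (fun=> 0) _ (fun=> 0) t0 u tu.
  rewrite E0 mul0r subr0 subrr; apply.
  - apply: within_itv_continuous => s /andP[ts su]; apply: cF.
    by rewrite ger0_norm ?subr_ge0 //; lra.
  - by apply: within_itv_continuous => s _; exact: cvg_cst.
  move=> s /andP[ts su].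
  have se : `|s - t0| < e by rewrite gtr0_norm ?subr_gt0 //; lra.
  have [_ _ /ler_normlP[? ?]] := H s se.
  split; [exact: dF|exact: c0|]; rewrite mulr_le0_ge0 ?expR_ge0 //; lra.
apply: (K L).
have := @der_le R (fun=> 0) (fun s => E s * expR (L * (s - t0))) (fun=> 0) _ u t0 ut.
rewrite subrr E0 mul0r sub0r oppr_ge0; apply.
- by apply: within_itv_continuous => s _; exact: cvg_cst.
- apply: within_itv_continuous => s /andP[us st]; apply: cF.
  by rewrite ler0_norm ?subr_le0 //; lra.
move=> s /andP[us st].
have se : `|s - t0| < e by rewrite ltr0_norm ?subr_lt0 //; lra.
have [_ _ /ler_normlP[? ?]] := H s se.
split; [exact: c0|exact: dF|]; rewrite mulr_ge0 ?expR_ge0 //; lra.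
Qed.

Variable p : nat.
Local Notation k := (p.+1%:R + 1 : R).

(** Gronwall's argument for the squared distance in the unknowns [(x, y, Z)]; [z] is then read off
    from [Z]. *)
Lemma regular_unique_near (x1 y1 z1 x2 y2 z2 : R -> R) (t0 e : R) : 0 < e ->
  regular_solution p [set u | `|u - t0| < e] x1 y1 z1 ->
  regular_solution p [set u | `|u - t0| < e] x2 y2 z2 ->
  triple x1 y1 z1 t0 = triple x2 y2 z2 t0 ->
  exists2 d, 0 < d & forall u, `|u - t0| < d -> triple x1 y1 z1 u = triple x2 y2 z2 u.
Proof.
move=> e0 s1 s2 [Ex Ey Ez].
pose a := t0 - e / 2; pose b := t0 + e / 2.
have near u : a <= u <= b -> `|u - t0| < e.
  by rewrite /a /b => /andP[? ?]; rewrite ltr_norml; apply/andP; split; lra.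
have inab u : `|u - t0| < e / 2 -> a <= u <= b.
  by rewrite /a /b => /ltr_normlP[? ?]; apply/andP; split; lra.
have cont (x y z : R -> R) (sol : regular_solution p [set u | `|u - t0| < e] x y z) u :
    a <= u <= b -> [/\ {for u, continuous x}, {for u, continuous y} & {for u, continuous z}].
  by move=> uab; apply: regular_continuous sol _; exact: near.
have bound (f : R -> R) : (forall u, a <= u <= b -> {for u, continuous f}) ->
    exists2 M, 0 <= M & forall t, a <= t <= b -> `|f t| <= M by exact: continuous_bounded_itv.
have [|Mx1 Mx10 mx1] := bound x1; first by move=> u /(cont _ _ _ s1)[].
have [|Mx2 Mx20 mx2] := bound x2; first by move=> u /(cont _ _ _ s2)[].
have [|My My0 my] := bound y2; first by move=> u /(cont _ _ _ s2)[].
have [|Mz Mz0 mz] := bound z2; first by move=> u /(cont _ _ _ s2)[].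
pose Mx := Num.max Mx1 Mx2.
have Mx0 : 0 <= Mx by rewrite le_max Mx10.
pose c : R := p.+2%:R / p.+1%:R.
have c0 : 0 <= c by rewrite divr_ge0.
pose n (x : R) := `|x| ^+ p.+1.
pose L0 := p.+1%:R * Mx ^+ p.
have L00 : 0 <= L0 by rewrite mulr_ge0 // exprn_ge0.
pose Nn := Mx ^+ p.+1.
have Nn0 : 0 <= Nn by rewrite exprn_ge0.
pose Z1 u := regular_acceleration p (x1 u) (y1 u) (z1 u).
pose Z2 u := regular_acceleration p (x2 u) (y2 u) (z2 u).
pose X u := `|x1 u - x2 u|; pose Y u := `|y1 u - y2 u|; pose Z u := `|Z1 u - Z2 u|.
pose S u := X u + Y u + Z u.
have dn u : a <= u <= b -> `|n (x1 u) - n (x2 u)| <= L0 * X u.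
  move=> uab; apply: le_trans (@expr_lipschitz _ Mx _ _ p _ _) _.
  - by rewrite normr_ge0 le_max mx1.
  - by rewrite normr_ge0 le_max mx2 ?orbT.
  - by apply: ler_wpM2l => //; exact: ler_dist_dist.
have bn u : a <= u <= b -> `|n (x1 u)| <= Nn.
  move=> uab; rewrite normrX normr_id /Nn lerXn2r ?nnegrE // le_max mx1 //.
(* [A] and [B] are Lipschitz constants, in the unknowns [(x, y, Z)], of [z] and of the derivative of
   [Z]. *)
pose A := 1 + c * (Nn + L0 * My).
pose B := Nn * A + L0 * Mz.
have A0 : 0 <= A by rewrite /A addr_ge0 // mulr_ge0 // addr_ge0 // mulr_ge0.
have B0 : 0 <= B by rewrite /B addr_ge0 // mulr_ge0.
have X0 u : 0 <= X u by exact: normr_ge0.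
have Y0 u : 0 <= Y u by exact: normr_ge0.
have Z0 u : 0 <= Z u by exact: normr_ge0.
have XS u : X u <= S u by rewrite /S -addrA lerDl addr_ge0.
have YS u : Y u <= S u by rewrite /S -addrA addrCA lerDl addr_ge0.
have ZS u : Z u <= S u by rewrite /S lerDr addr_ge0.
have S0 u : 0 <= S u by exact: le_trans (normr_ge0 _) (XS u).
have dz u : a <= u <= b -> `|z1 u - z2 u| <= A * S u.
  move=> uab.
  have -> : z1 u - z2 u = (Z1 u - Z2 u) - c * (n (x1 u) * (y1 u - y2 u) + (n (x1 u) - n (x2 u)) * y2 u).
    by rewrite /Z1 /Z2 /regular_acceleration /n /c; ring.
  apply: le_trans (ler_normB _ _) _.
  rewrite [leRHS](_ : _ = S u + c * (Nn * S u + L0 * S u * My)); last by rewrite /A; ring.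
  apply: lerD; first exact: ZS.
  rewrite normrM [`|c|]ger0_norm //; apply: ler_wpM2l => //.
  apply: le_trans (ler_normD _ _) _; rewrite !normrM; apply: lerD.
    by apply: ler_pM => //; [exact: bn|exact: YS].
  apply: ler_pM => //; last exact: my.
  by apply: le_trans (dn u uab) _; apply: ler_wpM2l => //; exact: XS.
have dZ u : a <= u <= b -> `|n (x1 u) * z1 u / p.+1%:R - n (x2 u) * z2 u / p.+1%:R| <= B * S u.
  move=> uab.
  have -> : n (x1 u) * z1 u / p.+1%:R - n (x2 u) * z2 u / p.+1%:R =
      (n (x1 u) * (z1 u - z2 u) + (n (x1 u) - n (x2 u)) * z2 u) / p.+1%:R by ring.
  rewrite normrM; apply: (@le_trans _ _ `|n (x1 u) * (z1 u - z2 u) + (n (x1 u) - n (x2 u)) * z2 u|).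
    by rewrite ler_piMr // normfV normr_nat invf_le1 ?ler1n // ltr0n.
  apply: le_trans (ler_normD _ _) _; rewrite !normrM.
  rewrite [leRHS](_ : _ = Nn * (A * S u) + L0 * S u * Mz); last by rewrite /B; ring.
  apply: lerD; apply: ler_pM => //; [exact: bn|exact: dz| |exact: mz].
  by apply: le_trans (dn u uab) _; apply: ler_wpM2l => //; exact: XS.
pose E u := (x1 u - x2 u) ^+ 2 + (y1 u - y2 u) ^+ 2 + (Z1 u - Z2 u) ^+ 2.
pose dE u := 2%:R * (x1 u - x2 u) ^+ 1 * (y1 u - y2 u) + 2%:R * (y1 u - y2 u) ^+ 1 * (z1 u - z2 u)
  + 2%:R * (Z1 u - Z2 u) ^+ 1 * (n (x1 u) * z1 u / p.+1%:R - n (x2 u) * z2 u / p.+1%:R).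
have E_0 : E t0 = 0.
  by rewrite /E /Z1 /Z2 Ex Ey Ez !subrr expr0n !addr0.
have E0 u : `|u - t0| < e / 2 -> E u = 0.
  (* The derivative is at most [2 (1 + A + B) S^2], and [S^2 <= 3 E]. *)
  apply: (gronwall0 (dE := dE) (L := 6 * (1 + A + B))) => // v ve.
  have vab := inab v ve.
  have [dx1 dy1 dZ1] := s1 v (near v vab); have [dx2 dy2 dZ2] := s2 v (near v vab).
  split.
  - by rewrite !addr_ge0 // sqr_ge0.
  - exact: (derD (derD (derX 2 (derD dx1 (derN dx2))) (derX 2 (derD dy1 (derN dy2)))) (derX 2 (derD dZ1 (derN dZ2)))).
  have SE : S v ^+ 2 <= 3 * E v.
    rewrite /E -![(_ - _) ^+ 2]real_normK ?num_real // -/(X v) -/(Y v) -/(Z v) /S.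
    exact: sqrrD3_le.
  apply: (@le_trans _ _ (2 * (1 + A + B) * S v ^+ 2)); last first.
    have : 0 <= 2 * (1 + A + B) by apply: mulr_ge0 => //; apply: addr_ge0 => //; exact: addr_ge0.
    by move=> /ler_wpM2l/(_ _ _ SE) h; apply: le_trans h _; rewrite le_eqVlt; apply/orP; left; apply/eqP; ring.
  rewrite [leRHS](_ : _ = 2 * S v * S v + 2 * S v * (A * S v) + 2 * S v * (B * S v)); last by ring.
  rewrite /dE !expr1; apply: le_trans (ler_normD _ _) _; apply: lerD.
    apply: le_trans (ler_normD _ _) _; rewrite !normrM !normr_nat; apply: lerD.
      apply: ler_pM; [exact: mulr_ge0|by []|apply: ler_wpM2l => //; exact: XS|exact: YS].
    apply: ler_pM; [exact: mulr_ge0|by []|apply: ler_wpM2l => //; exact: YS|exact: dz].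
  rewrite !normrM !normr_nat.
  by apply: ler_pM; [exact: mulr_ge0|by []|apply: ler_wpM2l => //; exact: ZS|exact: dZ].
exists (e / 2) => [|u ue]; first by rewrite divr_gt0.
move/eqP: (E0 u ue); rewrite !paddr_eq0 ?addr_ge0 ?sqr_ge0 // !sqrf_eq0 !subr_eq0.
move=> /andP[/andP[/eqP EX /eqP EY] /eqP EZ].
move: EZ; rewrite /Z1 /Z2 /regular_acceleration EY EX => /addIr EZ.
by rewrite /triple EX EY EZ.
Qed.

(** The times of agreement form an open set by local uniqueness, and so do the others by continuity.
    [P] is an equivalence between the two end points, hence transitive and usable in both directions
    of time. *)
Lemma trajectory_eq_regular (a b t0 : R) (g : R -> R * R * R) (x y z : R -> R) :
  chazy_trajectory p.+1 k `]a, b[%classic g -> regular_solution p setT x y z ->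
  (forall t, x t != 0 \/ y t != 0) -> a < t0 < b -> g t0 = triple x y z t0 ->
  forall t, a < t < b -> g t = triple x y z t.
Proof.
move=> traj sol xy t0ab Eg t tab.
have cg u : a < u < b -> {for u, continuous g} by exact: trajectory_continuous traj.
have ch u : {for u, continuous (triple x y z)}.
  by have [cx cy cz] := regular_continuous sol (I : setT u); exact: cvg_triple.
have gE u : g u = triple (fun u => (g u).1.1) (fun u => (g u).1.2) (fun u => (g u).2) u.
  by rewrite /triple; case: (g u) => [[]].
have loc u : a < u < b -> exists2 d, 0 < d &
    forall v w, `|v - u| < d -> `|w - u| < d -> g v = triple x y z v <-> g w = triple x y z w.
  move=> uab; have [gu|gu] := pselect (g u = triple x y z u).
    have [|e e0 sole] := trajectory_regular traj uab.
      by rewrite gu; case: (xy u) => [?|?]; [left|right; left].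
    have [||d d0 Hd] := @regular_unique_near _ _ _ x y z u e e0 sole.
    - by move=> v _; exact: sol.
    - by rewrite -gE.
    have Hd' v : `|v - u| < d -> g v = triple x y z v by move=> vd; rewrite gE Hd.
    by exists d => // v w vd wd; split => _; exact: Hd'.
  have e0 : 0 < `|g u - triple x y z u| by rewrite normr_gt0 subr_eq0; exact/eqP.
  have cdiff : {for u, continuous (fun u => g u - triple x y z u)}.
    by apply: cvgB; [exact: cg|exact: ch].
  have /cvgrPdist_lt/(_ _ e0)[d /= d0 Hd] := cdiff.
  have Hd' v : `|v - u| < d -> g v <> triple x y z v.
    by rewrite distrC => /Hd /[swap] ->; rewrite subrr subr0 ltxx.
  by exists d => // v w vd wd; split => /Hd'; case.
pose P (s u : R) := g s = triple x y z s <-> g u = triple x y z u.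
have seg c d : a < c -> d < b -> c <= d -> P c d.
  move=> ac db cd; apply: (@segment_gluing R P) => // [s u v _ _ _ _ [h1 h2] [h3 h4]|u /andP[cu ud]].
    by split; [move=> /h1/h3|move=> /h4/h2].
  have [|e e0 He] := loc u; first by rewrite (lt_le_trans ac) // (le_lt_trans ud).
  exists e => // s v /andP[su uv] cs vd es ve; apply: He; rewrite ltr_norml; apply/andP; split; lra.
have /andP[at0 t0b] := t0ab; have /andP[at_ tb] := tab.
have [t0t|/ltW tt0] := leP t0 t; first by have [h _] := seg t0 t at0 tb t0t; exact: h.
by have [_ h] := seg t t0 at_ t0b tt0; exact: h.
Qed.

End uniqueness.

(** * The cylinder *)

Section cylinder.
Context {R : realType}.
Variables (p : nat) (G : R -> R).
Hypothesis pG : profile p G.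
Hypothesis oG : G 1 = - G (-1).
Local Notation k := (p.+1%:R + 1 : R).
Local Notation beta := (2 / (2 * p.+1%:R + 1) : R).

(* A first integral of the system, homogeneous of degree [2 q + 2] under [dilate]. *)
Definition energy (v : R * R * R) : R :=
  v.1.2 ^+ 2 - 2 * (v.1.1 * v.2) - 2 * (v.1.1 * `|v.1.1| ^+ p.+1 * v.1.2).

Definition chazy_orbit (c : R * R) : R * R * R :=
  (orbit_x G c.1 c.2, orbit_y p G c.1 c.2, orbit_z p G c.1 c.2).

Lemma energy_orbit (c : R * R) : unit_circle c -> energy (chazy_orbit c) = 1.
Proof.
move=> cc; rewrite -(orbit_energy pG oG cc) /energy /chazy_orbit /orbit_z /orbit_y /acceleration /velocity /=.
have p0 : 0 <= p%:R :> R by [].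
by field; rewrite gt_eqF //; lra.
Qed.

Lemma energy_dilate (l : R) (v : R * R * R) : 0 < l ->
  energy (dilate p l v) = l ^+ (2 * p.+2) * energy v.
Proof.
move=> l0; rewrite /energy /dilate /= normrM gtr0_norm // [(l * `|_|) ^+ _]exprMn.
have -> : l ^+ (2 * p.+1).+1 = l ^+ p.+1 ^+ 2 * l by rewrite -exprM mulnC exprSr.
have -> : l ^+ (2 * p.+2) = (l ^+ p.+1 * l) ^+ 2 by rewrite -exprSr -exprM mulnC.
by rewrite [l ^+ p.+2]exprSr; ring.
Qed.

(* As [`|x| = a ^+ 2 / D] and [Y = b / sqrt D] on the orbit, [`|x| + Y ^+ 2] is [1 / D].
   One of the two square roots vanishes, as [Num.sqrt] is [0] on negative numbers. *)
Definition angle_of (x Y : R) : R * R :=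
  let m := rsqrt (`|x| + Y ^+ 2) in ((Num.sqrt x - Num.sqrt (- x)) * m, Y * m).

Lemma angle_of_orbit (c : R * R) : unit_circle c ->
  angle_of (orbit_x G c.1 c.2) (orbit_Y G c.1 c.2) = c.
Proof.
case: c => a b cc; have cab : a ^+ 2 + b ^+ 2 = 1 := cc.
have r0 : 0 < rsqrt (circle_denom G a b) by apply: rsqrt_gt0; exact: circle_denom_gt0 pG oG _ _ cab.
rewrite /= /angle_of /orbit_x /orbit_Y; set r := rsqrt (circle_denom G a b) in r0 *.
have -> : `|a * `|a| * r ^+ 2| + (b * r) ^+ 2 = r ^+ 2.
  rewrite [`|a * _ * _|]normrM [`|a * _|]normrM normr_id (ger0_norm (sqr_ge0 r)) -expr2 real_normK ?num_real //.
  by rewrite exprMn -mulrDl cab mul1r.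
have -> : rsqrt (r ^+ 2) = r^-1 by rewrite /rsqrt sqrtr_sqr gtr0_norm.
rewrite mulfK ?gt_eqF //; congr (_, _).
have [a0|/ltW a0] := leP 0 a.
  have -> : a * `|a| * r ^+ 2 = (a * r) ^+ 2 by rewrite ger0_norm //; ring.
  rewrite sqrtr_sqr ger0_norm ?mulr_ge0 // ?ltW //.
  by rewrite ler0_sqrtr ?oppr_le0 ?sqr_ge0 // subr0 mulfK // gt_eqF.
have -> : a * `|a| * r ^+ 2 = - (a * r) ^+ 2 by rewrite ler0_norm //; ring.
rewrite opprK sqrtr_sqr ler0_norm; last by rewrite mulr_le0_ge0 // ltW.
by rewrite ler0_sqrtr ?oppr_le0 ?sqr_ge0 // sub0r opprK mulfK // gt_eqF.
Qed.

Definition to_cylinder (w : R * R * R) : R * R * R := dilate p (expR w.2) (chazy_orbit w.1).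

(** A dilation by [expR s] multiplies the energy, 1 on the basic orbit, by [expR s ^+ (2 q + 2)];
    hence this is the height [s]. *)
Definition log_scale (v : R * R * R) : R := ln (energy v) / (2 * p.+2)%:R.

(** Dilates back to energy 1, recovers [Y] from [y], and reads the angle from [x] and [Y]; [z]
    enters through the energy alone. *)
Definition of_cylinder (v : R * R * R) : R * R * R :=
  let l := expR (- log_scale v) in
  let x := l * v.1.1 in
  (angle_of x (l ^+ p.+2 * v.1.2 + beta * (x * `|x| ^+ p.+1)), log_scale v).

Lemma log_scaleK (w : R * R * R) : unit_circle w.1 -> log_scale (to_cylinder w) = w.2.
Proof.
move=> cw; rewrite /log_scale energy_dilate ?expR_gt0 // energy_orbit // mulr1.
by rewrite -expRM_natl expRK mulrC mulKf // pnatr_eq0 muln_eq0.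
Qed.

Lemma to_cylinderK (w : R * R * R) : unit_circle w.1 -> of_cylinder (to_cylinder w) = w.
Proof.
move=> cw; rewrite /of_cylinder log_scaleK // /to_cylinder /dilate /=.
have E : expR (- w.2) * expR w.2 = 1 by rewrite -expRD addNr expR0.
have E1 n u : expR (- w.2) ^+ n * (expR w.2 ^+ n * u) = u.
  by rewrite mulrA -exprMn E expr1n mul1r.
rewrite (E1 1%N) E1 /orbit_y /velocity subrK.
by rewrite angle_of_orbit // -surjective_pairing.
Qed.

Lemma energy_to_cylinder (w : R * R * R) : unit_circle w.1 -> 0 < energy (to_cylinder w).
Proof.
by move=> cw; rewrite energy_dilate ?expR_gt0 // energy_orbit // mulr1 exprn_gt0 // expR_gt0.
Qed.

Lemma cont_dilate (T : topologicalType) (l x y z : T -> R) (t : T) :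
  {for t, continuous l} -> {for t, continuous x} -> {for t, continuous y} ->
  {for t, continuous z} ->
  {for t, continuous (fun u => dilate p (l u) (x u, y u, z u))}.
Proof.
move=> cl cx cy cz; apply: cvg_triple; first exact: contM.
  by apply: contM => //; exact: contX.
by apply: contM => //; exact: contX.
Qed.

Lemma continuous_to_cylinder (w : R * R * R) : unit_circle w.1 ->
  {for w, continuous to_cylinder}.
Proof.
move=> cw; have c1 := @continuous_triple1 R w; have c2 := @continuous_triple2 R w.
apply: cont_dilate.
- by apply: (@cont_comp R _ (@expR R)); [exact: continuous_triple3|exact: continuous_expR].
- by apply: (cont_orbit_x pG oG).
- by apply: (cont_orbit_y pG oG).
- by apply: (cont_orbit_z pG oG).
Qed.

Lemma continuous_energy (v : R * R * R) : {for v, continuous energy}.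
Proof.
rewrite /energy; have c1 := @continuous_triple1 R v; have c2 := @continuous_triple2 R v.
have c3 := @continuous_triple3 R v.
apply: contD; first apply: contD; first exact: contX.
  by apply/contN/contZ/contM.
by apply/contN/contZ/contM => //; apply: contM => //; exact/contX/cont_norm.
Qed.

Lemma continuous_of_cylinder (v : R * R * R) : 0 < energy v ->
  {for v, continuous of_cylinder}.
Proof.
move=> v0; have c1 := @continuous_triple1 R v; have c2 := @continuous_triple2 R v.
have cs : {for v, continuous log_scale}.
  rewrite /log_scale; apply: contM; last exact: cvg_cst.
  exact: (@cont_comp R _ (@ln R) energy v (@continuous_energy v) (continuous_ln v0)).
have cl : {for v, continuous (fun v => expR (- log_scale v))}.
  by apply: (@cont_comp R _ (@expR R) (fun v => - log_scale v) _ (contN cs)); exact: continuous_expR.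
pose x (v : R * R * R) := expR (- log_scale v) * v.1.1.
pose Y (v : R * R * R) := expR (- log_scale v) ^+ p.+2 * v.1.2 + beta * (x v * `|x v| ^+ p.+1).
have cx : {for v, continuous x} by exact: contM.
have cY : {for v, continuous Y}.
  apply: contD; first by apply: contM => //; exact: contX.
  by apply/contZ/contM => //; exact/contX/cont_norm.
(* If [x] and [Y] vanished, so would [y], and with [x = y = 0] the energy is 0. *)
have xY : 0 < `|x v| + Y v ^+ 2.
  rewrite lt_neqAle addr_ge0 ?sqr_ge0 // andbT eq_sym paddr_eq0 ?sqr_ge0 // normr_eq0 sqrf_eq0.
  apply/negP => /andP[/eqP x0]; rewrite /Y x0 mul0r mulr0 addr0 mulf_eq0 expf_eq0 /= gt_eqF ?expR_gt0 //= => /eqP y0.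
  move/eqP: x0; rewrite mulf_eq0 gt_eqF ?expR_gt0 //= => /eqP x0.
  by move: v0; rewrite /energy y0 x0 expr0n !mul0r mulr0 !subr0 ltxx.
have cm : {for v, continuous (fun v => rsqrt (`|x v| + Y v ^+ 2))}.
  apply: (@cont_comp _ _ rsqrt (fun v => `|x v| + Y v ^+ 2)); last exact: continuous_rsqrt.
  by apply: contD; [exact: cont_norm|exact: contX].
apply: cvg_triple => //; last exact: contM.
by apply: contM => //; apply: contD; [exact: cont_sqrt|exact/contN/cont_sqrt/contN].
Qed.

Lemma orbit_neq0 (c : R * R) : unit_circle c -> (chazy_orbit c).1.1 != 0 \/ (chazy_orbit c).1.2 != 0.
Proof.
move=> cc; have cab : c.1 ^+ 2 + c.2 ^+ 2 = 1 := cc.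
have r0 := rsqrt_gt0 (circle_denom_gt0 pG oG cab).
rewrite /chazy_orbit /= /orbit_y /velocity; have [x0|] := eqVneq (orbit_x G c.1 c.2) 0; last by left.
right; rewrite x0 mul0r mulr0 subr0 /orbit_Y; apply: mulf_neq0; last by rewrite gt_eqF.
apply/eqP => b0; move/eqP: x0; rewrite /orbit_x !mulf_eq0 normr_eq0 (gt_eqF r0) !orbb orbF.
by move=> /eqP a0; move: cab; rewrite a0 b0 expr0n addr0 => /eqP; rewrite eq_sym oner_eq0.
Qed.

Lemma circle_angle (c : R * R) : unit_circle c -> exists s : R, c = (sin s, cos s).
Proof.
case: c => a b cab; have {}cab : a ^+ 2 + b ^+ 2 = 1 := cab.
have b1 : -1 <= b <= 1 by apply/andP; split; nra.
have sq : Num.sqrt (1 - b ^+ 2) = `|a| by rewrite -cab addrK sqrtr_sqr.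
have [a0|/ltW a0] := leP 0 a.
  by exists (acos b); rewrite sin_acos // acosK ?in_itv // sq ger0_norm.
by exists (- acos b); rewrite sinN cosN sin_acos // acosK ?in_itv // sq ler0_norm // opprK.
Qed.

Lemma odd_profile_cylinder : exists C : set (R * R * R),
  chazy_invariant p.+1 k C /\ chazy_cylinder_foliated_by_periodic_orbits p.+1 k C.
Proof.
have [sg [T [T0 sgT sgS sgC sol]]] := periodic_regular_solution pG oG.
have scc (s : R) : unit_circle (sin s, cos s) by rewrite /unit_circle /= addrC cos2Dsin2.
pose A : set (R * R * R) := @unit_circle R `*` setT.
exists (to_cylinder @` A).
pose h (l c : R) : R -> R * R * R :=
  fun t => dilate p l (chazy_orbit (sin (sg (l ^+ p.+1 * t + c)), cos (sg (l ^+ p.+1 * t + c)))).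
have hE (s c t : R) : h (expR s) c t =
    to_cylinder (sin (sg (expR s ^+ p.+1 * t + c)), cos (sg (expR s ^+ p.+1 * t + c)), s) by [].
have hsol (l c : R) (l0 : 0 < l) := regular_solution_dilate c l0 sol.
split.
  move=> a b g traj t0 t0ab [[[a0 b0] s] [/= cab _] gE] t tab.
  have [th thE] := circle_angle cab.
  have [t1 t1E] := sgS th.
  pose l := expR s; have l0 : 0 < l := expR_gt0 s.
  (* The phase for which the dilated solution is at the parameter [t1] of the given point at time
     [t0]. *)
  pose c := t1 - l ^+ p.+1 * t0.
  have E := trajectory_eq_regular traj (hsol l c l0).
  have -> : g t = h l c t.
    rewrite !in_itv /= in t0ab tab; apply: (E _ _ t0ab _ t tab).
    - move=> u; have [x0|y0] := orbit_neq0 (scc (sg (l ^+ p.+1 * u + c))); [left|right].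
        by rewrite mulf_neq0 // gt_eqF.
      by rewrite mulf_neq0 // expf_neq0 // gt_eqF.
    - rewrite -gE; have -> : (a0, b0, s) = (sin (sg (l ^+ p.+1 * t0 + c)), cos (sg (l ^+ p.+1 * t0 + c)), s).
        by rewrite /c addrC subrK t1E thE.
      by [].
  by exists (sin (sg (l ^+ p.+1 * t + c)), cos (sg (l ^+ p.+1 * t + c)), s); first by split => //; exact: scc.
exists to_cylinder; split.
  exists of_cylinder; split.
  - by apply: continuous_in_subspaceT => w; rewrite inE => -[cw _]; exact: continuous_to_cylinder.
  - apply: continuous_in_subspaceT => v; rewrite inE => -[w [cw _] <-].
    by apply: continuous_of_cylinder; exact: energy_to_cylinder.
  - by move=> w [cw wT]; split; [exists w|exact: to_cylinderK].
  - by move=> _ [w [cw wT] <-]; rewrite to_cylinderK.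
move=> s; have l0 : 0 < expR s := expR_gt0 s.
have lq : 0 < expR s ^+ p.+1 by rewrite exprn_gt0.
(* Dilation by [l] divides the period by [l ^+ q]. *)
exists (h (expR s) 0), (T / expR s ^+ p.+1); split.
- apply: (regular_trajectory (hsol _ 0 l0)).
  apply: (@sub_countable _ _ _ ((fun t => t / expR s ^+ p.+1) @` [set t | sin (sg t) = 0])).
    apply: subset_card_le => t /= /eqP; rewrite addr0 mulf_eq0 (gt_eqF l0) /= => x0.
    exists (expR s ^+ p.+1 * t); last by rewrite mulrAC mulfV ?mul1r // gt_eqF.
    move: x0; rewrite /orbit_x !mulf_eq0 normr_eq0.
    by rewrite (gt_eqF (rsqrt_gt0 (circle_denom_gt0 pG oG (scc _)))) !orbb orbF => /eqP.
  by apply: sub_countable (card_image_le _ _) _.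
- exact: divr_gt0.
- by move=> t; rewrite /h mulrDr mulrCA mulfV ?gt_eqF // mulr1 !addr0 sgT sinD2pi cosD2pi.
(* The angles 0 and [pi] are antipodal on the circle, and [of_cylinder] tells their points apart. *)
- have [t1 t1E] := sgS 0; have [t2 t2E] := sgS pi.
  have tE (u : R) : expR s ^+ p.+1 * (u / expR s ^+ p.+1) + 0 = u.
    by rewrite addr0 mulrCA mulfV ?mulr1 // gt_eqF.
  exists (t1 / expR s ^+ p.+1), (t2 / expR s ^+ p.+1) => E.
  have := congr1 of_cylinder E; rewrite !hE !to_cylinderK /=; [|exact: scc|exact: scc].
  rewrite !tE t1E t2E sin0 cos0 sinpi cospi => -[E1].
  by lra.
- apply/seteqP; split => [_ [[c s'] [/= cc ->] <-]|_ [t _ <-]].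
    have [th ->] := circle_angle cc; have [t1 t1E] := sgS th.
    exists (t1 / expR s ^+ p.+1) => //.
    by rewrite hE addr0 mulrCA mulfV ?gt_eqF // mulr1 t1E.
  by rewrite hE; exists (sin (sg (expR s ^+ p.+1 * t + 0)), cos (sg (expR s ^+ p.+1 * t + 0)), s) => //; split => //; exact: scc.
Qed.

End cylinder.

Theorem corollary1 (R : realType) (q : nat) (k : R) :
  (1 <= q <= 100)%N -> k = q%:R + 1 ->
  exists C : set (R * R * R),
    chazy_invariant q k C /\ chazy_cylinder_foliated_by_periodic_orbits q k C.
Proof.
case: q => [//|p] _ ->; have [G pG oG] := @odd_profile R p.
exact: odd_profile_cylinder pG oG.
Qed.
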